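(* Let $N$ be even and let $g=g_{1,N}\in\mathbb{G}[x_1,\ldots,x_N]$ be the Raz–Yehudayoff polynomial described in the context. Let $f_1,\ldots,f_m$ be polynomials computed by multilinear $r$-pass ABPs of sizes $s_1,\ldots,s_m$ respectively, such that $g=f_1+\cdots+f_m$, and let $s=\max\{s_1,\ldots,s_m\}$. Then $m=\frac{2^{\Omega(N^{1/5})}}{s^{c(r+\log N)}}$ for a constant $c$; i.e. there are absolute constants $c,c'>0$ with $m\ge 2^{c'N^{1/5}}/s^{c(r+\log N)}$.
   Context: Let $\mathbb{F}$ be a field, $X=\{x_1,\ldots,x_N\}$ with $N$ even, $\mathcal{W}=\{w_{i,k,j}\}_{i,k,j\in[N]}$ further variables and $\mathbb{G}=\mathbb{F}(\mathcal{W})$. For an interval $[i,j]$ of even length define $g_{i,j}\in\mathbb{G}[X]$ by $g_{i,j}=1$ if $|[i,j]|=0$, and otherwise $g_{i,j}=(1+x_ix_j)g_{i+1,j-1}+\sum_k w_{i,k,j}g_{i,k}g_{k+1,j}$, the sum over $k\in[i+1,j-2]$ with $|[i,k]|$ even; $g=g_{1,N}$. An ABP is a layered DAG with start node $s$ and terminal node $t$, edges labelled by variables or constants, computing the sum over $s$-$t$ paths of the product of labels; size = number of nodes. It is syntactic multilinear if every variable occurs at most once on every $s$-$t$ path, and oblivious if for every layer at most one variable labels the edges leaving that layer. A multilinear $r$-pass ABP is an oblivious syntactic multilinear ABP for which there are permutations $\pi_1,\ldots,\pi_r$ of $[N]$ such that, from $s$ to $t$, the variables are read in the order $(x_{\pi_1(1)},\ldots,x_{\pi_1(N)}),\ldots,(x_{\pi_r(1)},\ldots,x_{\pi_r(N)})$.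 *)

(* Defs.v *)
From Stdlib Require Export Reals.
From HB Require Export structures.
From mathcomp Require Export all_boot all_order all_algebra all_fingroup.
From mathcomp Require Export mpoly.

Set Implicit Arguments.
Unset Strict Implicit.
Unset Printing Implicit Defensive.

Import GRing.Theory.

Open Scope ring_scope.

(* The algebra library rebinds the key %R to ring_scope. *)
Delimit Scope R_scope with coqR.

Section Vars.
Variables (F : fieldType) (N : nat).

Definition Wcount : nat := #|{: 'I_N * 'I_N * 'I_N}|.

Definition WField : fieldType := {fraction {mpoly F[Wcount]}}.

(* The elements of [N] = {1, ..., N} are represented by the naturals 1, ..., N;
   the variable of index k lives at position k.-1 of 'I_N. Indices outside
   1 .. N do not occur in ry 1 N, and get the junk value 0. *)
Definition idx (k : nat) : option 'I_N := insub k.-1.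

Definition xvar (k : nat) : {mpoly WField[N]} :=
  if idx k is Some a then 'X_a else 0.

Definition wvar (i k j : nat) : WField :=
  if (idx i, idx k, idx j) is (Some a, Some b, Some c)
  then tofrac 'X_(enum_rank (a, b, c)) else 0.

(* n is recursion fuel, n >= |[i, j]| being enough; see ryE. *)
Fixpoint ry_rec (n i j : nat) : {mpoly WField[N]} :=
  if n is n'.+1 then
    if (j < i)%N then 1 else
    (1 + xvar i * xvar j) * ry_rec n' i.+1 j.-1
    + \sum_(i.+1 <= k < j.-1 | ~~ odd (k.+1 - i))
        wvar i k j *: (ry_rec n' i k * ry_rec n' k.+1 j)
  else 1.

Definition ry (i j : nat) : {mpoly WField[N]} := ry_rec (j.+1 - i) i j.

Lemma ry_rec_fuel n i j :
  (0 < i)%N -> (j.+1 - i <= n)%N -> ry_rec n i j = ry i j.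
Proof.
rewrite /ry; elim/ltn_ind: n i j => -[|n] IH i j i_gt0.
  by rewrite leqn0 => /eqP->.
case: (ltnP j i) => [ji _|ij le_n].
  by have /eqP-> : (j.+1 - i == 0)%N by []; rewrite /= ji.
rewrite subSn //= ltnNge ij /=.
have le_n' : (j - i <= n)%N by move: le_n; rewrite subSn.
have j_gt0 : (0 < j)%N by apply: leq_trans ij.
have fuel m a b : (0 < a)%N -> (b.+1 - a <= j - i)%N -> (j - i <= m <= n)%N ->
    ry_rec m a b = ry_rec (b.+1 - a) a b.
  by move=> a_gt0 le_ab /andP[le_m lt_m]; rewrite IH // (leq_trans le_ab).
have jin : (j - i <= n <= n)%N by rewrite le_n' leqnn.
have jij : (j - i <= j - i <= n)%N by rewrite leqnn.
have step m : (j - i <= m <= n)%N ->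
    (1 + xvar i * xvar j) * ry_rec m i.+1 j.-1
    + \sum_(i.+1 <= k < j.-1 | ~~ odd (k.+1 - i))
        wvar i k j *: (ry_rec m i k * ry_rec m k.+1 j)
  = (1 + xvar i * xvar j) * ry_rec (j.-1.+1 - i.+1) i.+1 j.-1
    + \sum_(i.+1 <= k < j.-1 | ~~ odd (k.+1 - i))
        wvar i k j *: (ry_rec (k.+1 - i) i k * ry_rec (j.+1 - k.+1) k.+1 j).
  move=> hm; congr (_ * _ + _).
    by apply: fuel; rewrite // prednK // leq_sub2l.
  rewrite big_nat_cond [RHS]big_nat_cond; apply: eq_bigr => k.
  case/andP=> /andP[ik kj] _; congr (_ *: (_ * _)); apply: fuel => //.
    by rewrite leq_sub2r // (leq_trans kj) // leq_pred.
  by rewrite subSS leq_sub2l // ltnW.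
by rewrite (step n) // (step (j - i)%N).
Qed.

Lemma ry_empty i j : (j < i)%N -> ry i j = 1.
Proof. by rewrite /ry => ji; have /eqP-> : (j.+1 - i == 0)%N by []. Qed.

Lemma ryE i j : (0 < i)%N -> (i <= j)%N ->
  ry i j = (1 + xvar i * xvar j) * ry i.+1 j.-1
    + \sum_(i.+1 <= k < j.-1 | ~~ odd (k.+1 - i))
        wvar i k j *: (ry i k * ry k.+1 j).
Proof.
move=> i_gt0 ij; have j_gt0 : (0 < j)%N by apply: leq_trans ij.
rewrite {1}/ry subSn //= ltnNge ij /=.
congr (_ * _ + _); first by apply: ry_rec_fuel => //; rewrite prednK // leq_sub2l.
rewrite big_nat_cond [RHS]big_nat_cond; apply: eq_bigr => k.
case/andP=> /andP[ik kj] _; congr (_ *: (_ * _)); apply: ry_rec_fuel => //.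
  by rewrite leq_sub2r // (leq_trans kj) // leq_pred.
by rewrite subSS leq_sub2l // ltnW.
Qed.

End Vars.

Section ABP.
Variables (K : fieldType) (N : nat).

Definition label : eqType := ('I_N + K)%type.

Definition label_poly (l : label) : {mpoly K[N]} :=
  match l with inl i => 'X_i | inr c => c%:MP end.

Definition label_var (l : label) : option 'I_N :=
  if l is inl i then Some i else None.

Record abp := Abp {
  node : finType;
  depth : nat;
  layer : node -> nat;
  source : node;
  sink : node;
  arc : node -> node -> option label; (* None when there is no edge *)
  source_layer : layer source = 0%N;
  sink_layer : layer sink = depth;
  arc_layer : forall u v, arc u v -> layer v = (layer u).+1
}.

Section Notions.
Variable P : abp.

Definition abp_size : nat := #|node P|.

Definition st_path (p : seq (node P)) : bool :=
  path (fun u v => isSome (arc u v)) (source P) p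
  && (last (source P) p == sink P).

Definition path_labels (p : seq (node P)) : seq label :=
  pmap (fun e => arc e.1 e.2) (zip (source P :: p) p).

(* p lists the nodes following the source; as the graph is layered, no node
   repeats on a path, so a path has less than abp_size edges. *)
Definition abp_poly : {mpoly K[N]} :=
  \sum_(d < abp_size) \sum_(p : d.-tuple (node P) | st_path p)
    \prod_(l <- path_labels p) label_poly l.

Definition syntactic_multilinear : Prop :=
  forall p : seq (node P), st_path p -> uniq (pmap label_var (path_labels p)).

Definition layer_vars (l : nat) : seq 'I_N :=
  [seq i <- enum 'I_N | [exists u : node P, exists v : node P,
     (layer u == l) && (arc u v == Some (inl i : label))]].

Definition oblivious : Prop := forall l : nat, (size (layer_vars l) <= 1)%N.

Definition read_order : seq 'I_N :=
  flatten [seq layer_vars l | l <- iota 0 (depth P)].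

Definition passes (r : nat) (pi : 'I_r -> {perm 'I_N}) : seq 'I_N :=
  flatten [seq [seq pi k i | i <- enum 'I_N] | k <- enum 'I_r].

(* subseq and not equality: a pass need not read every variable. *)
Definition multilinear_pass (r : nat) : Prop :=
  [/\ oblivious, syntactic_multilinear &
      exists pi : 'I_r -> {perm 'I_N}, subseq read_order (passes pi)].

End Notions.
End ABP.

Definition log2 (x : R) : R := (ln x / ln 2)%coqR.

(* Main.v *)
(** Evaluating at Boolean points turns a polynomial into a function on subsets
    of the variables. Fix a balanced colouring [Y] of the variables and call a
    function [R]-separable if it is a sum of [R] products of a function of the
    variables in [Y] and a function of the others.

    Under every balanced colouring the Raz-Yehudayoff polynomial is not
    [R]-separable for any [R < 2^(N/2)]: either the two ends of an interval have
    different colours and [1 + x_i x_j] contributes a nonsingular factor, or the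
    interval splits into two balanced ones, and then a generic [w_{i,k,j}] makes
    the product term dominate.

    Conversely, fixing the nodes at which the paths of an [r]-pass program cross
    the [r] pass boundaries writes it as a sum of [s^r] read-once programs, since
    by multilinearity the variables read in the different passes are then
    disjoint. A read-once program, cut into [k] blocks of [B] consecutive
    variables each, is separable with [s^(k+1) 2^(N/2 - e)] terms, where [2 e] is
    the sum of the colour discrepancies of the blocks. For a random colouring most
    blocks have discrepancy of order [sqrt B], except with probability [2^-k];
    this beats [s^k] as soon as [log s] is small against [sqrt B]. Taking
    [k = N^(1/5)] and a union bound over the [m s^r] read-once programs gives the
    theorem. *)
Require Import Defs.
From mathcomp Require Import zify.
From Stdlib Require Import Lra.

Set Implicit Arguments.
Unset Strict Implicit.
Unset Printing Implicit Defensive.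

Import GRing.Theory.

(** * Separable functions *)

Definition depends (V : finType) (X : Type) (T : {set V}) (f : {set V} -> X) :=
  forall A B : {set V}, A :&: T = B :&: T -> f A = f B.

Lemma depends_sub (V : finType) (X : Type) (T T' : {set V}) (f : {set V} -> X) :
  T \subset T' -> depends T f -> depends T' f.
Proof.
move=> sT fT A B AB; apply: fT.
by rewrite -(setIidPr sT) !setIA AB.
Qed.

Section Separable.
Variables (K : fieldType) (V : finType).
Implicit Types (A B T Y : {set V}) (f g : {set V} -> K).

(** The index type is arbitrary with cardinality bounded by [R], so that sums and products of
    separable functions are indexed by sum and product types. *)
Definition sep Y R f := exists (I : finType) (p q : I -> {set V} -> K),
  [/\ (#|I| <= R)%N, forall i, depends Y (p i), forall i, depends (~: Y) (q i)
    & forall A, f A = \sum_i p i A * q i A].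

Lemma sep_leq Y R R' f : (R <= R')%N -> sep Y R f -> sep Y R' f.
Proof.
by move=> le [I [p [q [cI pY qY fE]]]]; exists I, p, q; split=> //; apply: leq_trans le.
Qed.

Lemma sep_ext Y R f g : f =1 g -> sep Y R f -> sep Y R g.
Proof.
by move=> e [I [p [q [cI pY qY fE]]]]; exists I, p, q; split=> // A; rewrite -e.
Qed.

Lemma sepD Y R R' f g : sep Y R f -> sep Y R' g ->
  sep Y (R + R') (fun A => f A + g A).
Proof.
move=> [I [p [q [cI pY qY fE]]]] [J [p' [q' [cJ pY' qY' gE]]]].
exists (I + J)%type,
  (fun s => match s with inl i => p i | inr j => p' j end),
  (fun s => match s with inl i => q i | inr j => q' j end).
split=> [|[]|[]|A] //; first by rewrite card_sum leq_add.
by rewrite fE gE big_sumType.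
Qed.

Lemma sepM Y R R' f g : sep Y R f -> sep Y R' g ->
  sep Y (R * R') (fun A => f A * g A).
Proof.
move=> [I [p [q [cI pY qY fE]]]] [J [p' [q' [cJ pY' qY' gE]]]].
exists (I * J)%type, (fun s A => p s.1 A * p' s.2 A), (fun s A => q s.1 A * q' s.2 A).
split=> [|s A B e|s A B e|A]; first by rewrite card_prod leq_mul.
- by rewrite (pY s.1 A B e) (pY' s.2 A B e).
- by rewrite (qY s.1 A B e) (qY' s.2 A B e).
rewrite fE gE big_distrlr /= pair_bigA /=; apply: eq_bigr => -[i j] _ /=.
by rewrite mulrACA.
Qed.

Lemma sep0 Y R : sep Y R (fun=> 0).
Proof.
exists void, (fun _ _ => 0), (fun _ _ => 0).
by split=> // [|A]; [rewrite card_void | rewrite big1 //; case].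
Qed.

Lemma sep_sum Y R (J : Type) (s : seq J) (f : J -> {set V} -> K) :
  (forall j, sep Y R (f j)) -> sep Y (size s * R) (fun A => \sum_(j <- s) f j A).
Proof.
move=> fR; elim: s => [|j s IH].
  by apply: sep_ext (sep0 Y _) => A; rewrite big_nil.
have e A : f j A + \sum_(i <- s) f i A = \sum_(i <- j :: s) f i A.
  by rewrite big_cons.
by apply: sep_ext e _; rewrite mulSn; apply: sepD.
Qed.

Lemma sep_sum_in Y R (J : finType) (U : {pred J}) (f : J -> {set V} -> K) :
  (forall j, j \in U -> sep Y R (f j)) ->
  sep Y (#|U| * R) (fun A => \sum_(j in U) f j A).
Proof.
move=> fR.
have e A : \sum_(j <- enum U) (if j \in U then f j A else 0) = \sum_(j in U) f j A.
  by rewrite big_enum; apply: eq_bigr => j jU; rewrite jU.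
apply: sep_ext e _; rewrite cardE; apply: sep_sum => j.
by case jU: (j \in U); [apply: fR | apply: sep0].
Qed.

Lemma sepC Y R f : sep Y R f -> sep (~: Y) R f.
Proof.
move=> [I [p [q [cI pY qY fE]]]]; exists I, q, p; split=> // [i|A].
  by rewrite setCK.
by rewrite fE; apply: eq_bigr => i _; rewrite mulrC.
Qed.

(** One term per possible trace [C] of [A] on [T :&: Y]: the indicator of that trace, times [f] with
    the trace frozen to [C]. *)
Lemma sep_depends1 Y T f : depends T f -> sep Y (2 ^ #|T :&: Y|) f.
Proof.
move=> fT; exists {C : {set V} | C \in powerset (T :&: Y)},
  (fun C A => (A :&: (T :&: Y) == sval C)%:R),
  (fun C A => f (sval C :|: (A :\: Y))).
split=> [|C A B e|C A B e|A].
- by rewrite card_sig -(card_powerset (T :&: Y)).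
- by case: C => C /= _; rewrite (setIC T) !setIA e.
- by case: C => C /= _; rewrite !setDE e.
have AT : A :&: (T :&: Y) \in powerset (T :&: Y) by rewrite powersetE subsetIr.
pose C0 : {C : {set V} | C \in powerset (T :&: Y)} :=
  exist (fun C => C \in powerset (T :&: Y)) _ AT.
rewrite (bigD1 C0) //= eqxx mul1r big1 ?addr0.
  apply: fT; apply/setP=> x; rewrite !inE.
  by case: (x \in A); case: (x \in T); case: (x \in Y).
move=> C neC; case: eqP => [e|]; last by rewrite mul0r.
by case/eqP: neC; apply: val_inj; rewrite /= e.
Qed.

(** The traces on either colour class may be enumerated; choosing the smaller class is what turns
    colour discrepancy into a saving. *)
Lemma sep_depends Y T f : depends T f ->
  sep Y (2 ^ minn #|T :&: Y| #|T :\: Y|) f.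
Proof.
move=> fT; case: leqP => _; first exact: sep_depends1.
by have /sepC := sep_depends1 (~: Y) fT; rewrite setCK -setDE.
Qed.

End Separable.

(** * Nondegenerate functions *)

Section Nondegenerate.
Variables (K : fieldType) (V : finType) (Y : {set V}).
Implicit Types (A B C I J : {set V}) (f g : {set V} -> K).

Definition mix A B := (A :&: Y) :|: (B :\: Y).

(* A column is a pair whose first component fixes the coordinates outside of
   [I :&: Y]: this tensors the matrix of [g] with an identity matrix, so that the
   row kernels for different sets [I] live in the same space. *)
Definition ndmx I g :
    'M[K]_(#|{set V}|, #|{: {set V} * {set V}}|) :=
  \matrix_(i, j) (let A := enum_val i in let A0B := enum_val j in
    if A :\: (I :&: Y) == A0B.1 :\: (I :&: Y) then g (mix A A0B.2) else 0).

Definition nondeg I g := row_free (ndmx I g).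

Lemma nondegP I g : reflect
  (forall phi : {set V} -> K,
     (forall C B, \sum_(A | A :\: (I :&: Y) == C :\: (I :&: Y))
                    phi A * g (mix A B) = 0) ->
     forall A, phi A = 0)
  (nondeg I g).
Proof.
have ndE (v : 'rV_#|{set V}|) j : (v *m ndmx I g) 0 j =
    \sum_(A | A :\: (I :&: Y) == (enum_val j).1 :\: (I :&: Y))
       v 0 (enum_rank A) * g (mix A (enum_val j).2).
  rewrite mxE (reindex enum_rank) /=; last first.
    by exists enum_val => i _; rewrite ?enum_rankK ?enum_valK.
  rewrite [RHS]big_mkcond; apply: eq_bigr => A _.
  by rewrite mxE /= enum_rankK; case: ifP => _ //; rewrite mulr0.
apply: (iffP idP) => [gI phi phi0 A|gI].
  pose v : 'rV_#|{set V}| := \row_i phi (enum_val i).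
  have : v *m ndmx I g == 0.
    apply/eqP/rowP=> j; rewrite ndE mxE -[RHS](phi0 (enum_val j).1 (enum_val j).2).
    by apply: eq_bigr => B _; rewrite mxE enum_rankK.
  rewrite (mulmx_free_eq0 _ gI) => /eqP/rowP/(_ (enum_rank A)).
  by rewrite !mxE enum_rankK.
apply: inj_row_free => v v0.
have phi0 : forall A, v 0 (enum_rank A) = 0.
  apply: gI => C B; move/rowP/(_ (enum_rank (C, B))): v0.
  by rewrite ndE enum_rankK mxE.
by apply/rowP=> i; rewrite mxE -(enum_valK i) phi0.
Qed.

Lemma nondeg_ext I f g : f =1 g -> nondeg I f -> nondeg I g.
Proof.
move=> e; rewrite /nondeg; suff -> : ndmx I f = ndmx I g by [].
by apply/matrixP=> i j; rewrite !mxE /= e.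
Qed.

Lemma nondeg_set0 : nondeg set0 (fun=> 1).
Proof.
apply/nondegP=> phi phi0 A; have := phi0 A set0.
rewrite set0I (eq_bigl (pred1 A)) ?big_pred1_eq ?mulr1 // => B.
by rewrite /= !setD0.
Qed.

(** Tensor product argument: summing [phi] against [g] over the coordinates in [J :&: Y] gives a
    function of [C], which vanishes by nondegeneracy of [f]; then nondegeneracy of [g] kills
    [phi]. *)
Lemma nondegM I J f g : [disjoint I & J] -> depends I f -> depends J g ->
  nondeg I f -> nondeg J g -> nondeg (I :|: J) (fun A => f A * g A).
Proof.
move=> dIJ fI gJ /nondegP ndf /nondegP ndg; apply/nondegP=> phi phi0.
have IJ x : ~ (x \in I /\ x \in J).
  by move=> [xI xJ]; rewrite (disjointFr dIJ xI) in xJ.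
apply: ndg => C B; move: C; apply: ndf => C B'.
rewrite -[RHS](phi0 C ((B' :&: I) :|: (B :\: I))).
under eq_bigr do rewrite big_distrl /=.
rewrite (exchange_big_dep xpredT) //= [RHS]big_mkcond; apply: eq_bigr => A _.
case: ifP => AC; last first.
  apply: big1 => A' /andP[/eqP e1 /eqP e2]; move: AC => /negP; case.
  apply/eqP/setP=> x; move/setP/(_ x): e1; move/setP/(_ x): e2; rewrite !inE.
  by case: (x \in I); case: (x \in J); case: (x \in Y); case: (x \in A);
     case: (x \in C); case: (x \in A').
(* For each [A] exactly one intermediate set contributes: it follows [A] on [I :&: Y] and [C]
   elsewhere. *)
rewrite (big_pred1 ((A :&: (I :&: Y)) :|: (C :\: (I :&: Y)))) /=.
  rewrite mulrAC -mulrA; congr (_ * (_ * _)).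
    apply: fI; apply/setP=> x; rewrite !inE.
    by case: (x \in I); case: (x \in Y); case: (x \in A); rewrite ?andbF ?andbT ?orbF.
  apply: gJ; apply/setP=> x; move: (IJ x); rewrite !inE.
  case: (x \in J); last by rewrite !andbF.
  by case: (x \in I) => [[] //|_]; rewrite !andbF !andbT.
move=> A' /=; apply/andP/eqP => [[/eqP e1 /eqP e2]|->].
  apply/setP=> x; move/setP/(_ x): e1; move/setP/(_ x): e2; move: (IJ x).
  rewrite !inE; case: (x \in I); case: (x \in J) => //;
  by case: (x \in Y); case: (x \in A); case: (x \in C); case: (x \in A') => // -[].
split; apply/eqP/setP=> x; move/eqP/setP/(_ x): AC; move: (IJ x); rewrite !inE;
  case: (x \in I); case: (x \in J);
  by case: (x \in Y); case: (x \in A); case: (x \in C) => // -[].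
Qed.

(** On these two coordinates the matrix is [[[1, 1], [1, 2]]], of determinant 1 in every
    characteristic. *)
Lemma nondeg_pair i j : i \in Y -> j \notin Y ->
  nondeg [set i; j] (fun A => 1 + (i \in A)%:R * (j \in A)%:R).
Proof.
move=> iY jY; have ij : j != i by apply: contra jY => /eqP->.
have -> : [set i; j] = [set j; i] by rewrite setUC.
apply/nondegP=> phi phi0.
have IY : [set j; i] :&: Y = [set i].
  apply/setP=> x; rewrite !inE; case: (eqVneq x i) => [->|_]; first by rewrite iY orbT.
  by rewrite orbF; case: eqP => // ->; rewrite (negbTE jY).
have phi_i A : i \in A -> phi A = 0.
  move=> iA; have := congr2 (fun x y => x - y) (phi0 A [set j]) (phi0 A set0).
  rewrite /= subrr IY -sumrB (bigD1 A) //= big1 ?addr0; last first.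
    move=> B /andP[/eqP e neB]; case iB: (i \in B).
      by case/eqP: neB; rewrite -(setD1K iA) -e setD1K.
    by rewrite !inE iB iY /= !mul0r subrr.
  by rewrite !inE iA iY (negbTE jY) !eqxx /= !andbF /= mul1r mulr0 addr0 mulr1 mulrDr !mulr1
             addrAC subrr add0r.
move=> A; case iA: (i \in A); first exact: phi_i.
have := phi0 A set0; rewrite IY (bigD1 A) //= big1 ?addr0.
  by rewrite !inE iA iY /= mul0r addr0 mulr1.
move=> B /andP[/eqP e neB]; case iB: (i \in B); first by rewrite phi_i ?mul0r.
case/eqP: neB; apply/setP=> x; move/setP/(_ x): e; rewrite !inE.
by case: eqP => // ->; rewrite iA iB.
Qed.

(** With [B] a right inverse of the matrix of [g], a left kernel vector at [c] is an eigenvector of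
    [M] for the eigenvalue [c]. There are finitely many eigenvalues, and [e] supplies infinitely
    many candidates. *)
Lemma nondeg_perturb (e : nat -> K) I f g : injective e ->
  nondeg I g -> exists c, nondeg I (fun A => f A + c * g A).
Proof.
move=> e_inj /row_freeP[B gB]; pose M := - (ndmx I f *m B).
have nzM : char_poly M != 0 by apply/monic_neq0/char_poly_monic.
have /allPn[c _ rc] : ~~ all (root (char_poly M)) (mkseq e (size (char_poly M))).
  apply/negP=> /(max_poly_roots nzM).
  by rewrite mkseq_uniq // size_mkseq ltnn => /(_ isT).
exists c; apply: inj_row_free => v v0; apply/eqP/contraT => nzv.
rewrite -eigenvalue_root_char in rc; case/negP: rc; apply/eigenvalueP.
exists v => //; move/(congr1 (mulmx^~ B)): v0; rewrite /= mul0mx.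
have -> : ndmx I (fun A => f A + c * g A) = ndmx I f + c *: ndmx I g.
  by apply/matrixP=> i j; rewrite !mxE /=; case: ifP => // _; rewrite mulr0 addr0.
rewrite -mulmxA mulmxDl -scalemxAl gB mulmxDr -scalemxAr mulmx1 mulmxN => /eqP.
by rewrite addrC addr_eq0 => /eqP ->.
Qed.

(** With fewer terms than subsets of [Y], the rows of the matrix [Q] of left factors are linearly
    dependent; the dependency, extended by zero to all sets, is a left kernel vector for [f]. *)
Lemma nondeg_sep R f : nondeg setT f -> sep Y R f -> (2 ^ #|Y| <= R)%N.
Proof.
move=> /nondegP nd [I [p [q [cI pY qY fE]]]].
rewrite -card_powerset; apply: leq_trans cI; rewrite leqNgt; apply/negP=> lt.
pose Q : 'M[K]_(#|powerset Y|, #|I|) := \matrix_(i, j) p (enum_val j) (enum_val i).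
have : kermx Q != 0.
  rewrite kermx_eq0; apply/negP=> /eqP rQ.
  by move: (rank_leq_col Q); rewrite rQ leqNgt lt.
case/rowV0Pn=> v /sub_kermxP vQ /eqP; apply.
have Y0 : set0 \in powerset Y by rewrite powersetE sub0set.
pose phi A := if A \in powerset Y then v 0 (enum_rank_in Y0 A) else 0.
suff phi0 A : phi A = 0.
  apply/rowP=> i; rewrite mxE; have := phi0 (enum_val i).
  by rewrite /phi enum_valP enum_valK_in.
move: A; apply: nd => C B; rewrite setTI.
under eq_bigr do rewrite fE big_distrr /=.
rewrite exchange_big big1 //= => i _.
transitivity ((\sum_(A | A :\: Y == C :\: Y) phi A * p i A) * q i B).
  rewrite big_distrl /=; apply: eq_bigr => A _; rewrite -mulrA; congr (_ * (_ * _)).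
    by apply: pY; apply/setP=> x; rewrite !inE; case: (x \in Y); rewrite ?andbF ?andbT ?orbF.
  by apply: qY; apply/setP=> x; rewrite !inE; case: (x \in Y); rewrite ?andbF ?andbT.
suff -> : \sum_(A | A :\: Y == C :\: Y) phi A * p i A = 0 by rewrite mul0r.
(* If [C] leaves [Y], so does every set of its class, and [phi] vanishes on all of them. *)
have [CY|CY] := boolP (C :\: Y == set0); last first.
  apply: big1 => A /eqP e; rewrite /phi powersetE -setD_eq0 e (negbTE CY).
  by rewrite mul0r.
rewrite (eq_bigl (fun A => A \in powerset Y)) => [|A]; last first.
  by rewrite (eqP CY) powersetE -setD_eq0.
transitivity ((v *m Q) 0 (enum_rank i)); last by rewrite vQ mxE.
rewrite mxE big_enum_val; apply: eq_bigr => j _.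
by rewrite /phi enum_valP enum_valK_in mxE enum_rankK.
Qed.

End Nondegenerate.

(** Row freeness is witnessed by a maximal minor, a determinant over [D]. Being nonzero after [f],
    it is nonzero in [D] and stays so under the injective [h]. Thus one good specialisation settles
    the generic case. *)
Lemma row_free_transfer (D : idomainType) (K L : fieldType)
    (f : {rmorphism D -> K}) (h : {rmorphism D -> L}) m n (M : 'M[D]_(m, n)) :
  injective h -> row_free (map_mx f M) -> row_free (map_mx h M).
Proof.
move=> h_inj freeM.
have full : row_full (map_mx f M)^T by rewrite /row_full mxrank_tr.
pose k := fullrankfun full.
have : rowsub k (map_mx f M)^T \in unitmx by apply: fullrowsub_unit.
have -> : rowsub k (map_mx f M)^T = map_mx f (rowsub k M^T).
  by apply/matrixP=> i j; rewrite !mxE.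
rewrite unitmxE det_map_mx unitfE => nz.
have : map_mx h (rowsub k M^T) \in unitmx.
  rewrite unitmxE det_map_mx unitfE; apply: contra nz.
  by rewrite -(rmorph0 h) => /eqP/h_inj->; rewrite rmorph0.
have -> : map_mx h (rowsub k M^T) = (colsub k (map_mx h M))^T.
  by apply/matrixP=> i j; rewrite !mxE.
rewrite unitmx_tr -row_free_unit => /row_freeP[B MB].
apply/row_freeP; exists (colsub k 1%:M *m B).
by rewrite mulmxA mulmx_colsub mulmx1.
Qed.

(** * The Raz-Yehudayoff polynomial *)

Section RazYehudayoffValue.
Variable A : comNzRingType.
Implicit Types (w : nat -> nat -> nat -> A) (x : nat -> A).

(** The recursion of [ry_rec] with parameters and arguments in any commutative ring, so that it
    commutes with ring morphisms and [w] can be specialised. *)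
Fixpoint ryval w x (n i j : nat) : A :=
  if n is n'.+1 then
    if (j < i)%N then 1 else
    (1 + x i * x j) * ryval w x n' i.+1 j.-1
    + \sum_(i.+1 <= k < j.-1 | ~~ odd (k.+1 - i))
        w i k j * (ryval w x n' i k * ryval w x n' k.+1 j)
  else 1.

Lemma eq_ryval w w' x x' n i j :
  (forall a k b, (i <= a)%N -> (a <= k <= b)%N -> (b <= j)%N -> w a k b = w' a k b) ->
  (forall k, (i <= k <= j)%N -> x k = x' k) ->
  ryval w x n i j = ryval w' x' n i j.
Proof.
elim: n i j => //= n IH i j ww xx; case: ltnP => // ij.
rewrite !xx ?leqnn ?ij //; congr (_ * _ + _).
  by apply: IH => [a k b ? ? ?|k ?]; [apply: ww; lia | apply: xx; lia].
rewrite big_nat_cond [RHS]big_nat_cond; apply: eq_bigr => k /andP[/andP[ik kj] _].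
rewrite ww ?leqnn //; last by lia.
congr (_ * (_ * _)); apply: IH => [a l b ? ? ?|l ?];
  by [apply: ww; lia | apply: xx; lia].
Qed.

End RazYehudayoffValue.

Lemma rmorph_ryval (A B : comNzRingType) (f : {rmorphism A -> B}) w x n i j :
  f (ryval w x n i j) = ryval (fun i k j => f (w i k j)) (f \o x) n i j.
Proof.
elim: n i j => [|n IH] i j /=; first exact: rmorph1.
case: ltnP => _; first exact: rmorph1.
rewrite rmorphD rmorphM rmorphD rmorph1 rmorphM IH rmorph_sum.
by congr (_ + _); apply: eq_bigr => k _; rewrite !rmorphM !IH.
Qed.

(* [k] is the first return to zero of the colour walk starting at [i]. *)
Lemma balanced_split (p : pred nat) (i j : nat) : (i < j)%N -> p i = p j ->
  ((\sum_(i <= l < j.+1) p l) * 2 = j.+1 - i)%N ->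
  exists k, [/\ (i < k)%N, (k.+1 < j)%N &
    ((\sum_(i <= l < k.+1) p l) * 2 = k.+1 - i)%N].
Proof.
wlog pi : p / p i.
  move=> W ij pij b; case pi: (p i); first exact: W.
  have C k : (\sum_(i <= l < k.+1) p l + \sum_(i <= l < k.+1) predC p l = k.+1 - i)%N.
    rewrite -big_split /= -[RHS]muln1 -sum_nat_const_nat.
    by apply: eq_bigr => l _; case: (p l).
  have p'i : predC p i by rewrite /= pi.
  have p'ij : predC p i = predC p j by rewrite /= pij.
  have b' : ((\sum_(i <= l < j.+1) predC p l) * 2 = j.+1 - i)%N.
    by have := C j; lia.
  have [k [ik kj e]] := W _ p'i ij p'ij b'.
  by exists k; split=> //; have := C k; lia.
move=> ij pij b.
pose c k := (\sum_(i <= l < k.+1) p l)%N.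
have cS k : (i <= k)%N -> c k.+1 = (c k + p k.+1)%N.
  by move=> ik; rewrite /c big_nat_recr //= ltnW.
(* [k] will be the first index at which the colour of [i] is no longer a strict majority. The index
   [j.-1] qualifies: dropping [j], coloured like [i], from a balanced interval leaves a minority. *)
have ex : exists k, (i <= k)%N && (c k * 2 <= k.+1 - i)%N.
  exists j.-1; have := cS j.-1; rewrite prednK; last by lia.
  by rewrite -pij pi; move: b; rewrite -/(c j); lia.
case: (ex_minnP ex) => k /andP[ik ck] kmin.
have ci : c i = 1%N by rewrite /c big_nat1 pi.
have ki : k <> i by move=> e; move: ck; rewrite e ci; lia.
have kj1 : (k <= j.-1)%N.
  apply: kmin; have := cS j.-1; rewrite prednK; last by lia.
  by rewrite -pij pi; move: b; rewrite -/(c j); lia.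
have ck' : ~~ (c k.-1 * 2 <= k.-1.+1 - i)%N.
  apply/negP=> h; have := kmin k.-1; rewrite h andbT; lia.
have := cS k.-1; rewrite prednK; last by lia.
move=> cS'; have {}cS' : c k = (c k.-1 + p k)%N by apply: cS'; lia.
have e : (c k * 2 = k.+1 - i)%N by lia.
exists k; split=> //; first by lia.
have := cS j.-1; rewrite prednK; last by lia.
rewrite -pij pi; move: b; rewrite -/(c j).
case: (eqVneq k j.-1) => [ej|]; last by lia.
by rewrite -ej; lia.
Qed.

(** * Nondegeneracy for suitable values of the parameters *)

Section FullRank.
Variables (N : nat) (Y : {set 'I_N}).

Definition interval i j : {set 'I_N} := [set a : 'I_N | (i <= a.+1 <= j)%N].

Definition bitval (K : nzRingType) (S : {set 'I_N}) (k : nat) : K :=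
  if idx N k is Some a then (a \in S)%:R else 0.

Definition inY k := if idx N k is Some a then a \in Y else false.

Lemma idxS (a : 'I_N) : idx N a.+1 = Some a.
Proof. by rewrite /idx /= valK. Qed.

Lemma idx_some k : (0 < k <= N)%N -> {a : 'I_N | idx N k = Some a & a.+1 = k}.
Proof.
move=> kN; have lt : (k.-1 < N)%N by lia.
by exists (Ordinal lt); rewrite ?(idxS (Ordinal lt)) /=; rewrite -?(idxS (Ordinal lt)) /= prednK //; lia.
Qed.

Lemma bitval_depends (K : fieldType) i j k (S S' : {set 'I_N}) :
  (0 < i)%N -> (j <= N)%N -> (i <= k <= j)%N ->
  S :&: interval i j = S' :&: interval i j -> bitval K S k = bitval K S' k.
Proof.
move=> i0 jN kij e; rewrite /bitval; case: (@idx_some k) => [|a -> ak]; first by lia.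
by move/setP/(_ a): e; rewrite !inE ak kij !andbT => ->.
Qed.

Lemma ryval_depends (K : fieldType) (w : nat -> nat -> nat -> K) n i j :
  (0 < i)%N -> (j <= N)%N ->
  depends (interval i j) (fun S => ryval w (bitval K S) n i j).
Proof.
move=> i0 jN S S' e; apply: eq_ryval => // k kij.
exact: (bitval_depends K i0 jN kij e).
Qed.

Variables (K : fieldType) (e : nat -> K).
Hypothesis e_inj : injective e.

Lemma ryval_nondeg n i j : (0 < i)%N -> (j <= N)%N -> (j.+1 - i <= n)%N ->
  ((\sum_(i <= l < j.+1) inY l) * 2 = j.+1 - i)%N ->
  exists w, nondeg Y (interval i j) (fun S => ryval w (bitval K S) n i j).
Proof.
have itv0 a b : (b < a)%N -> interval a b = set0.
  by move=> ba; apply/setP=> x; rewrite !inE; lia.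
elim: n i j => [|n IH] i j i0 jN le_n bal.
  by exists (fun _ _ _ => 0); rewrite itv0; [exact: nondeg_set0 | lia].
have [ji|ij] := ltnP j i.
  exists (fun _ _ _ => 0); rewrite itv0 //=.
  by apply: nondeg_ext (nondeg_set0 K Y) => S; rewrite ji.
have {}ij : (i < j)%N.
  by rewrite ltn_neqAle ij andbT; apply/eqP=> ji; move: bal; rewrite ji; lia.
have [a ia ai] : {a : 'I_N | idx N i = Some a & a.+1 = i} by apply: idx_some; lia.
have [b jb bj] : {b : 'I_N | idx N j = Some b & b.+1 = j} by apply: idx_some; lia.
have xi S : bitval K S i = (a \in S)%:R by rewrite /bitval ia.
have xj S : bitval K S j = (b \in S)%:R by rewrite /bitval jb.
have [eij|neij] := eqVneq (inY i) (inY j).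
  have [k [ik kj balk]] := balanced_split ij eij bal.
  have balk' : ((\sum_(k.+1 <= l < j.+1) inY l) * 2 = j.+1 - k.+1)%N.
    by move: bal; rewrite (@big_cat_nat _ _ _ k.+1) /=; lia.
  have [w1 nd1] : exists w, nondeg Y (interval i k) (fun S => ryval w (bitval K S) n i k).
    by apply: IH; lia.
  have [w2 nd2] : exists w, nondeg Y (interval k.+1 j) (fun S => ryval w (bitval K S) n k.+1 j).
    by apply: IH; lia.
  have ndM : nondeg Y (interval i k :|: interval k.+1 j) (fun S =>
      ryval w1 (bitval K S) n i k * ryval w2 (bitval K S) n k.+1 j).
    apply: nondegM => //; try by apply: ryval_depends; lia.
    by rewrite -setI_eq0; apply/eqP/setP=> x; rewrite !inE; lia.
  have itvU : interval i k :|: interval k.+1 j = interval i j.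
    by apply/setP=> x; rewrite !inE; lia.
  rewrite itvU in ndM.
  (* Parameters inside the two halves come from [w1] and [w2], [w i k j] is the free scalar [c], and
     all others are 0, so that only the split at [k] survives. *)
  pose w c := fun p q s => if (i <= p)%N && (s <= k)%N then w1 p q s else
    if (k < p)%N && (s <= j)%N then w2 p q s else
    if [&& p == i, q == k & s == j] then c else 0.
  (* The first summand lives on [[i+1, j-1]], where [w c] does not involve [c]; it may be taken at
     [w 0]. *)
  have [c ndc] := nondeg_perturb (fun S => (1 + bitval K S i * bitval K S j) *
    ryval (w 0) (bitval K S) n i.+1 j.-1) e_inj ndM.
  exists (w c); apply: nondeg_ext ndc => S /=.
  rewrite ltnNge ltnW //=; congr (_ * _ + _).
    apply: eq_ryval => // p q s ip ps sj; rewrite /w; case: ifP => // _; case: ifP => // _.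
    by case: eqP => //; lia.
  have wij q : w c i q j = if q == k then c else 0.
    by rewrite /w leqnn leqNgt (_ : k < j)%N /= ?ltnNge ?(ltnW ik) ?eqxx ?andbT //; lia.
  have kI : k \in index_iota i.+1 j.-1 by rewrite mem_index_iota; lia.
  rewrite big_mkcond (bigD1_seq k) ?iota_uniq //=.
  rewrite big1 => [|q qk]; last by case: ifP => // _; rewrite wij (negbTE qk) mul0r.
  rewrite addr0 wij eqxx ifT; last by lia.
  congr (_ * (_ * _)); apply: eq_ryval => // p q s h1 h2 h3; rewrite /w.
    by rewrite h1 h3.
  by rewrite ifF ?h1 ?h3 //; lia.
have pY : nondeg Y [set a; b] (fun S => 1 + (a \in S)%:R * (b \in S)%:R : K).
  move: neij; rewrite /inY ia jb; case: (boolP (a \in Y)) => aY;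
    case: (boolP (b \in Y)) => bY // _; first exact: nondeg_pair.
  rewrite setUC; apply: nondeg_ext (nondeg_pair K bY aY) => S.
  by rewrite mulrC.
have [w ndw] : exists w, nondeg Y (interval i.+1 j.-1)
    (fun S => ryval w (bitval K S) n i.+1 j.-1).
  apply: IH; try lia.
  have j1 : j.-1.+1 = j by lia.
  have ij1 : (i.+1 <= j)%N by [].
  move: bal; rewrite big_ltn; last by lia.
  rewrite big_nat_recr //= j1.
  by move: neij; case: (inY i); case: (inY j) => //= _; lia.
(* All splittings of [[i, j]] are switched off, which leaves a product over disjoint sets; the inner
   interval never uses these parameters. *)
exists (fun p q s => if (p == i) && (s == j) then 0 else w p q s).
have -> : interval i j = [set a; b] :|: interval i.+1 j.-1.
  by apply/setP=> x; rewrite !inE -!val_eqE /=; lia.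
apply: nondeg_ext (nondegM _ _ _ pY ndw) => [S /=|||].
- rewrite ltnNge ltnW //= xi xj [X in _ = _ + X]big1 ?addr0 => [|q _]; last first.
    by rewrite !eqxx mul0r.
  congr (_ * _); apply: eq_ryval => // p q s ip ps sj.
  by case: eqP => //; lia.
- by rewrite -setI_eq0; apply/eqP/setP=> x; rewrite !inE -!val_eqE /=; lia.
- by move=> S S' eS; move/setP: eS => eS; have := eS a; have := eS b;
     rewrite !inE !eqxx orbT !andbT => -> ->.
- by apply: ryval_depends; lia.
Qed.

End FullRank.

(** * From special to generic parameters *)

Section RazYehudayoffRank.
Variables (F : fieldType) (N : nat).
Local Notation W := {mpoly F[Wcount N]}.

Definition bool_eval (K : fieldType) (p : {mpoly K[N]}) (S : {set 'I_N}) : K :=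
  p.@[fun a => (a \in S)%:R].

(** Specialisations are ring morphisms on polynomials but not on their fraction field, hence this
    version of [wvar] before the embedding. *)
Definition wpoly (i k j : nat) : W :=
  if (idx N i, idx N k, idx N j) is (Some a, Some b, Some c)
  then 'X_(enum_rank (a, b, c)) else 0.

Lemma tofrac_injective (D : idomainType) : injective (@tofrac D).
Proof. by move=> x y /eqP; rewrite tofrac_eq => /eqP. Qed.

Lemma wvarE i k j : wvar F N i k j = tofrac (wpoly i k j).
Proof.
rewrite /wvar /wpoly; case: (idx N i) => [a|]; last by rewrite rmorph0.
case: (idx N k) => [b|]; last by rewrite rmorph0.
by case: (idx N j) => [c|]; last by rewrite rmorph0.
Qed.

Lemma bool_eval_ry_rec n i j S :
  bool_eval (ry_rec F N n i j) S = tofrac (ryval wpoly (bitval W S) n i j).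
Proof.
rewrite rmorph_ryval /bool_eval; elim: n i j => [|n IH] i j /=; first exact: meval1.
have xE k : (xvar F N k).@[fun a => (a \in S)%:R] = tofrac (bitval W S k).
  rewrite /xvar /bitval; case: (idx N k) => [a|]; last by rewrite meval0 rmorph0.
  by rewrite mevalXU rmorph_nat.
case: ltnP => _; first exact: meval1.
rewrite mevalD mevalM mevalD meval1 mevalM !xE IH raddf_sum /=; congr (_ + _).
by apply: eq_bigr => k _; rewrite mevalZ mevalM !IH wvarE.
Qed.

Lemma ry_sep (Y : {set 'I_N}) (R : nat) : (#|Y| * 2 = N)%N -> sep Y R (bool_eval (ry F N 1 N)) ->
  (2 ^ #|Y| <= R)%N.
Proof.
move=> YN; apply: nondeg_sep.
(* [F] may be finite; the powers of the variable give infinitely many values in [F(t)]. *)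
pose K : fieldType := {fraction {poly F}}.
pose e n : K := tofrac 'X^n.
have e_inj : injective e.
  by move=> m n /tofrac_injective/(congr1 (size : {poly F} -> nat)); rewrite !size_polyXn => -[].
have bal : ((\sum_(1 <= l < N.+1) inY Y l) * 2 = N.+1 - 1)%N.
  rewrite subn1 /= -[RHS]YN -sum1_card big_add1 /= big_mkord [in RHS]big_mkcond /=.
  congr (_ * 2)%N; apply: eq_bigr => a _.
  by rewrite /inY idxS; case: (a \in Y).
have [w] := ryval_nondeg e_inj (isT : (0 < 1)%N) (leqnn N) (leqnn _) bal.
have -> : interval N 1 N = setT by apply/setP=> a; rewrite !inE /= ltn_ord.
pose f : {rmorphism F -> K} := @tofrac _ \o @polyC F.
pose h (t : 'I_(Wcount N)) : K :=
  let: (a, b, c) := enum_val t in w a.+1 b.+1 c.+1.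
pose phi : {rmorphism W -> K} := mmap f h.
pose G (S : {set 'I_N}) := ryval wpoly (bitval W S) (N.+1 - 1) 1 N.
(* The nondegeneracy matrix over the polynomial ring: [phi] maps it to the specialised matrix,
   [tofrac] to the generic one. *)
pose M : 'M[W]_(#|{set 'I_N}|, #|{: {set 'I_N} * {set 'I_N}}|) :=
  \matrix_(i, j) (let A := enum_val i in let A0B := enum_val j in
    if A :\: (setT :&: Y) == A0B.1 :\: (setT :&: Y) then G (mix Y A A0B.2) else 0).
move=> ndw; have : row_free (map_mx phi M).
  move: ndw; rewrite /nondeg; congr (row_free _).
  apply/matrixP=> i j; rewrite !mxE /=; case: ifP => _; last by rewrite rmorph0.
  rewrite rmorph_ryval; apply: eq_ryval => [a k b a0 akb bN|k kN] /=.
    case: (@idx_some N a) => [|a' ea <-]; first by lia.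
    case: (@idx_some N b) => [|b' eb <-]; first by lia.
    case: (@idx_some N k) => [|k' ek <-]; first by lia.
    by rewrite /wpoly !idxS /= mmapX mmap1U /h enum_rankK.
  by rewrite /bitval; case: (idx N k) => [a|]; rewrite ?rmorph_nat ?rmorph0.
move=> /(row_free_transfer (h := @tofrac W) (@tofrac_injective _)).
rewrite /nondeg; congr (row_free _); apply/matrixP=> i j; rewrite !mxE /=.
by case: ifP => _; rewrite ?rmorph0 // /ry bool_eval_ry_rec.
Qed.

End RazYehudayoffRank.

(** * Random colourings *)

Local Open Scope nat_scope.

Lemma leq_bin_central n k : 'C(n.*2, k) <= 'C(n.*2, n).
Proof.
wlog le_kn : k / k <= n.
  move=> W; have [/W//|lt_nk] := leqP k n.
  have [le_k|lt] := leqP k n.*2; last by rewrite bin_small.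
  by rewrite -bin_sub // W //; lia.
move: (le_kn); rewrite -{2}(subKn le_kn); move: (n - k) (leq_subr k n) => d.
elim: d => [|d IH] lt_dn; first by rewrite subn0.
move=> _; apply: leq_trans (IH _ _); try lia.
have e := mul_bin_left n.*2 (n - d.+1).
rewrite (_ : (n - d.+1).+1 = n - d) in e; last by lia.
have pos : 0 < n - d by lia.
rewrite -(leq_pmul2l pos) e leq_mul2r; apply/orP; right; lia.
Qed.

(** The central coefficient is the largest of the [2n + 1] terms. Hence balanced colourings form at
    least a fraction [1 / (N + 1)] of all colourings. *)
Lemma exp4_leq_bin n : 4 ^ n <= n.*2.+1 * 'C(n.*2, n).
Proof.
have -> : 4 ^ n = 2 ^ n.*2 by rewrite -mul2n expnM.
rewrite -[2]/(1 + 1) expnDn -[X in X * _]card_ord -sum_nat_const.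
by apply: leq_sum => i _; rewrite !exp1n !muln1 leq_bin_central.
Qed.

(** The bound [4^n / sqrt (2n + 1)] on the central coefficient, squared to stay in the natural
    numbers. *)
Lemma bin_central_sqr n : 'C(n.*2, n) ^ 2 * n.*2.+1 <= 16 ^ n.
Proof.
elim: n => // n IH; set c := 'C(n.*2, n) in IH.
have e : n.+1 * 'C(n.+1.*2, n.+1) = 2 * (n.*2.+1 * c).
  have := mul_bin_diag n.*2.+1 n; rewrite /= -/c => ->.
  rewrite doubleS binS -[in X in _ + X]bin_sub; last by lia.
  by rewrite (_ : n.*2.+1 - n = n.+1); lia.
have pos : 0 < n.+1 ^ 2 by rewrite expn_gt0.
rewrite -(leq_pmul2l pos) mulnA -expnMn e [16 ^ n.+1]expnS.
move: IH; move: (16 ^ n) => X IH.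
have -> : (2 * (n.*2.+1 * c)) ^ 2 * n.+1.*2.+1 =
  (c ^ 2 * n.*2.+1) * (4 * n.*2.+1 * n.+1.*2.+1) by nia.
apply: leq_trans (leq_mul IH (leqnn _)) _.
rewrite mulnC [leqRHS]mulnA leq_mul2r; apply/orP; right; nia.
Qed.

Section RandomColoring.
Variable V : finType.
Implicit Types (T Y : {set V}).

Lemma card_setfam : #|{set V}| = 2 ^ #|V|.
Proof.
rewrite -[in RHS]cardsT -card_powerset; apply: eq_card => Y.
by rewrite powersetE subsetT.
Qed.

(** Independence of [f] and [g] for a uniform random colouring. On pairs of colourings, exchanging
    the parts inside [T] is an involution that turns [f A * g A] into [f A * g B]. *)
Lemma sum_independent T (f g : {set V} -> nat) :
  depends (~: T) f -> depends T g ->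
  2 ^ #|V| * (\sum_Y f Y * g Y) = (\sum_Y f Y) * (\sum_Y g Y).
Proof.
move=> fT gT; rewrite big_distrlr /= pair_bigA /=.
have -> : 2 ^ #|V| * (\sum_Y f Y * g Y) = \sum_(p : {set V} * {set V}) f p.1 * g p.1.
  rewrite -(pair_bigA _ (fun A B : {set V} => f A * g A)) /= big_distrr /=.
  apply: eq_bigr => A _; by rewrite sum_nat_const card_setfam.
pose h (p : {set V} * {set V}) :=
  ((p.1 :\: T) :|: (p.2 :&: T), (p.2 :\: T) :|: (p.1 :&: T)).
have hK : involutive h.
  move=> [A B]; rewrite /h /=; congr (_, _); apply/setP=> x; rewrite !inE;
  by case: (x \in T); rewrite ?andbF ?andbT ?orbF.
rewrite (reindex_inj (inv_inj hK)) /=; apply: eq_bigr => -[A B] _ /=.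
congr (_ * _); [apply: fT | apply: gT]; apply/setP=> x; rewrite !inE;
  by case: (x \in T); rewrite ?andbF ?andbT ?orbF.
Qed.

(** Weights on disjoint blocks are independent, so their means, at most 2 each, multiply. *)
Lemma sum_prod_blocks (T : nat -> {set V}) (g : nat -> {set V} -> nat) K :
  (forall b b', b < b' -> b' < K -> [disjoint T b & T b']) ->
  (forall b, b < K -> depends (T b) (g b)) ->
  (forall b, b < K -> \sum_Y g b Y <= 2 * 2 ^ #|V|) ->
  \sum_Y \prod_(b < K) g b Y <= 2 ^ K * 2 ^ #|V|.
Proof.
elim: K => [|K IH] dT gT g2.
  rewrite (eq_bigr (fun=> 1)) => [|Y _]; last by rewrite big_ord0.
  by rewrite sum1_card mul1n card_setfam.
rewrite (eq_bigr (fun Y => (\prod_(b < K) g b Y) * g K Y)) => [|Y _]; last first.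
  by rewrite big_ord_recr.
have pos : 0 < 2 ^ #|V| by rewrite expn_gt0.
rewrite -(leq_pmul2l pos) (@sum_independent (T K)); last exact: gT.
  apply: leq_trans (leq_mul (IH _ _ _) (g2 _ (leqnn _))) _.
  - by move=> b b' bb' b'K; apply: dT => //; apply: ltnW.
  - by move=> b bK; apply: gT; apply: ltnW.
  - by move=> b bK; apply: g2; apply: ltnW.
  by rewrite expnS; nia.
move=> A B AB; apply: eq_bigr => b _; apply: (gT b); first by apply: ltnW; rewrite ltnS.
apply: (depends_sub (X := {set V}) (T := T b) (T' := ~: T K) (f := fun A => A :&: T b)) AB.
  by rewrite -disjoints_subset; apply: dT.
by move=> ? ? ->.
Qed.

(** As the two parts of [T] add up to [#|T|], this says that their sizes differ by less than [t],
    without subtraction. *)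
Definition nearly_balanced (t : nat) T Y := #|T| < minn #|T :&: Y| #|T :\: Y| * 2 + t.

Lemma card_set_sum (P : pred {set V}) : #|[set Y | P Y]| = \sum_Y P Y.
Proof.
rewrite -sum1_card big_mkcond; apply: eq_bigr => Y _.
by rewrite inE; case: (P Y).
Qed.

Lemma card_setI_eq T k :
  #|[set Y | #|T :&: Y| == k]| = 'C(#|T|, k) * 2 ^ (#|V| - #|T|).
Proof.
pose D := [set A : {set V} | A \subset T & #|A| == k].
rewrite -(cards_draws T k) -/D.
have -> : #|V| - #|T| = #|~: T| by rewrite [RHS]cardsCs setCK.
rewrite -card_powerset -cardsX.
rewrite -(card_in_imset (f := fun p : {set V} * {set V} => p.1 :|: p.2)); last first.
  move=> [A B] [A' B']; rewrite !inE /= => /andP[/andP[sA _] sB] /andP[/andP[sA' _] sB'] e.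
  have im (C D' : {set V}) x : C \subset D' -> (x \in C) ==> (x \in D').
    by move=> /subsetP CD; apply/implyP/CD.
  congr (_, _); apply/setP=> x; move/setP/(_ x): e;
    move: (im _ _ x sA) (im _ _ x sA') (im _ _ x sB) (im _ _ x sB'); rewrite !inE;
  by case: (x \in A); case: (x \in A'); case: (x \in B); case: (x \in B');
     case: (x \in T).
apply: eq_card => Y; rewrite inE; apply/idP/imsetP => [TY|[[A B]]].
  exists (T :&: Y, Y :\: T); rewrite /= ?inE ?subsetIl ?TY /=.
    by rewrite setDE subsetIr.
  by rewrite setIC setID.
rewrite !inE /= => /andP[/andP[sA /eqP <-] sB] ->; apply/eqP/eq_card => x.
have : (x \in A) ==> (x \in T) by apply/implyP/(subsetP sA).
have : (x \in B) ==> (x \in ~: T) by apply/implyP/(subsetP sB).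
by rewrite !inE; case: (x \in A); case: (x \in B); case: (x \in T).
Qed.

(** Near balance leaves at most [2t] values for [#|T :&: Y|], each of probability at most
    [1 / sqrt (2n + 1)]; the hypothesis on [t] brings the total down to [1/16]. *)
Lemma card_nearly_balanced t n T : #|T| = n.*2 -> (16 * t.*2) ^ 2 <= n.*2 ->
  #|[set Y | nearly_balanced t.*2 T Y]| * 16 <= 2 ^ #|V|.
Proof.
move=> Tn tn; have TV : n.*2 <= #|V| by rewrite -Tn max_card.
have le : #|[set Y | nearly_balanced t.*2 T Y]| <=
    \sum_(n - t <= k < n + t) #|[set Y | #|T :&: Y| == k]|.
  under eq_bigr do rewrite card_set_sum.
  rewrite card_set_sum exchange_big /=; apply: leq_sum => Y _.
  case: (boolP (nearly_balanced _ _ _)) => //= uY.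
  have kI : #|T :&: Y| \in index_iota (n - t) (n + t).
    have := cardsID Y T; move: uY; rewrite /nearly_balanced mem_index_iota Tn; lia.
  by rewrite (bigD1_seq _ kI (iota_uniq _ _)) /= eqxx.
apply: leq_trans (leq_mul le (leqnn 16)) _.
have {le} : \sum_(n - t <= k < n + t) #|[set Y | #|T :&: Y| == k]| <=
    t.*2 * ('C(n.*2, n) * 2 ^ (#|V| - n.*2)).
  apply: leq_trans (_ : _ <= \sum_(n - t <= k < n + t) ('C(n.*2, n) * 2 ^ (#|V| - n.*2))) _.
    by apply: leq_sum => k _; rewrite card_setI_eq Tn leq_mul2r leq_bin_central orbT.
  by rewrite sum_nat_const_nat leq_mul2r; apply/orP; right; lia.
move=> le; apply: leq_trans (leq_mul le (leqnn 16)) _.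
have -> : 2 ^ #|V| = 4 ^ n * 2 ^ (#|V| - n.*2).
  by rewrite -[4]/(2 ^ 2) -expnM mul2n -expnD subnKC.
rewrite mulnA mulnAC leq_mul2r; apply/orP; right.
rewrite -(@leq_exp2r _ _ 2) //.
have := bin_central_sqr n.
have -> : (4 ^ n) ^ 2 = 16 ^ n by rewrite -expnM mulnC expnM.
apply: leq_trans; rewrite (_ : _ * 'C(n.*2, n) * 16 = 'C(n.*2, n) * (16 * t.*2)); last by nia.
by rewrite expnMn leq_mul2l (leq_trans tn) ?orbT.
Qed.

(** Markov's inequality for the weight 16 to the number of nearly balanced blocks. Each block factor
    has mean at most [1 + 16/16 = 2], so the weight has mean at most [2 ^ K], while half of the
    blocks already give [4 ^ K]. *)
Lemma card_many_nearly_balanced t n K (T : nat -> {set V}) :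
  (16 * t.*2) ^ 2 <= n.*2 -> (forall b, b < K -> #|T b| = n.*2) ->
  (forall b b', b < b' -> b' < K -> [disjoint T b & T b']) ->
  #|[set Y | K <= (\sum_(b < K) nearly_balanced t.*2 (T b) Y) * 2]| * 2 ^ K <= 2 ^ #|V|.
Proof.
move=> tn Tn dT.
have pos : 0 < 2 ^ K by rewrite expn_gt0.
rewrite -(leq_pmul2l pos) mulnCA -expnMn -[2 * 2]/4.
pose g b Y := 16 ^ nearly_balanced t.*2 (T b) Y.
apply: leq_trans (sum_prod_blocks (g := g) dT _ _).
- rewrite card_set_sum big_distrl; apply: leq_sum => Y _ /=.
  case: (boolP (K <= _)) => le; last by rewrite mul0n.
  rewrite mul1n /g -expn_sum -[16]/(4 ^ 2) -expnM leq_exp2l //.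
  by rewrite [2 * _]mulnC.
- move=> b _ A B AB; rewrite /g /nearly_balanced.
  have -> : T b :&: A = T b :&: B by rewrite setIC AB setIC.
  have -> : T b :\: A = T b :\: B; last by [].
  apply/setP=> x; move/setP/(_ x): AB; rewrite !inE.
  by case: (x \in T b); rewrite ?andbF ?andbT // => ->.
move=> b bK; have := card_nearly_balanced (Tn b bK) tn.
rewrite card_set_sum => le.
apply: leq_trans (_ : _ <= \sum_(Y : {set V}) (1 + nearly_balanced t.*2 (T b) Y * 16)) _.
  by apply: leq_sum => Y _; rewrite /g; case: nearly_balanced.
rewrite big_split /= -big_distrl /= [leqRHS]mulSn mul1n leq_add //.
by rewrite sum1_card card_setfam.
Qed.

End RandomColoring.

Local Open Scope ring_scope.

(** * Read-once programs *)

Section Walk.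
Variables (K : fieldType) (V T : finType).
Implicit Types (A : nat -> T -> T -> {set V} -> K) (lam : V -> nat).

(** Entry [(u, v)] of the product of the [n] transition matrices that start with [A l]. *)
Fixpoint walk A l n u v S : K :=
  if n is n'.+1 then \sum_w A l u w S * walk A l.+1 n' w v S else (u == v)%:R.

Lemma walkD A l n m u v S :
  walk A l (n + m) u v S = \sum_w walk A l n u w S * walk A (l + n) m w v S.
Proof.
elim: n l u => [|n IH] l u /=.
  rewrite (bigD1 u) //= eqxx mul1r addn0 big1 ?addr0 // => w.
  by rewrite eq_sym => /negbTE->; rewrite mul0r.
under eq_bigr do rewrite IH big_distrr /=.
rewrite exchange_big /=; apply: eq_bigr => w _.
rewrite big_distrl /=; apply: eq_bigr => w' _.
by rewrite mulrA addnS.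
Qed.

Lemma walk_depends A lam l n u v :
  (forall l u v, depends [set x | lam x == l] (A l u v)) ->
  depends [set x | (l <= lam x < l + n)%N] (walk A l n u v).
Proof.
move=> Alam; elim: n l u => [|n IH] l u S S' e //=.
apply: eq_bigr => w _; congr (_ * _).
  apply: depends_sub (Alam l u w) _ _ e; apply/subsetP=> x; rewrite !inE; lia.
apply: depends_sub (IH l.+1 w) _ _ e; apply/subsetP=> x; rewrite !inE; lia.
Qed.

Definition slab lam (d : nat -> nat) b : {set V} :=
  [set x | (d b <= lam x < d b.+1)%N].

(** Each slab costs a sum over the node at its start. The first one does too, since the induction
    begins with the walk of length 0; hence the exponent [k]. *)
Lemma walk_sep A lam d k Y u v :
  (forall l u v, depends [set x | lam x == l] (A l u v)) ->
  (forall b, (b < k)%N -> (d b <= d b.+1)%N) ->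
  sep Y (#|T| ^ k * 2 ^ (\sum_(b < k)
           minn #|slab lam d b :&: Y| #|slab lam d b :\: Y|))
    (walk A (d 0) (d k - d 0) u v).
Proof.
move=> Alam; elim: k v => [|k IH] v dmono.
  rewrite big_ord0 subnn muln1 expn0.
  have dep0 : depends set0 (walk A (d 0) 0 u v) by [].
  by have := sep_depends Y dep0; rewrite set0I set0D cards0.
have le0 : (d 0 <= d k)%N.
  elim: {IH} k dmono => // k IHk dmono.
  by apply: leq_trans (IHk _) (dmono _ _) => // b bk; apply: dmono; lia.
have lek : (d k <= d k.+1)%N by apply: dmono.
have e S : \sum_w walk A (d 0) (d k - d 0) u w S * walk A (d k) (d k.+1 - d k) w v S
         = walk A (d 0) (d k.+1 - d 0) u v S.
  rewrite (_ : d k.+1 - d 0 = (d k - d 0) + (d k.+1 - d k))%N; last by lia.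
  by rewrite walkD subnKC.
apply: sep_ext e _; rewrite expnS big_ord_recr /= expnD -mulnA.
apply: sep_sum_in => w _; rewrite mulnA; apply: sepM.
  by apply: IH => b bk; apply: dmono; lia.
by apply: sep_depends; have := @walk_depends A lam (d k) (d k.+1 - d k) w v Alam; rewrite subnKC.
Qed.

(** As no two variables share a layer, moving the cut just past the next layer that holds one adds
    exactly one variable. *)
Lemma injective_cut lam n : injective lam -> (n <= #|V|)%N ->
  exists l, #|[set x | (lam x < l)%N]| = n.
Proof.
move=> lam_inj; elim: n => [|n IH] nV.
  by exists 0%N; apply/eqP; rewrite cards_eq0; apply/eqP/setP=> x; rewrite !inE.
have [l cl] := IH (ltnW nV).
have ex : exists l', (l <= l')%N && [exists x, lam x == l'].
  have : [set x | (lam x < l)%N] != setT.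
    by apply/eqP=> e; move: nV; rewrite -cl e cardsT ltnn.
  rewrite -subTset => /subsetPn[x _]; rewrite inE -leqNgt => lx.
  by exists (lam x); rewrite lx; apply/existsP; exists x.
case: (ex_minnP ex) => l' /andP[ll' /existsP[x /eqP xl']] lmin.
exists l'.+1; rewrite -cl.
have -> : [set y | (lam y < l'.+1)%N] = x |: [set y | (lam y < l)%N].
  apply/setP=> y; rewrite !inE ltnS -(inj_eq lam_inj) xl'.
  case: (ltnP (lam y) l) => ly; first by rewrite orbT; lia.
  have := lmin (lam y); rewrite ly /=.
  have -> : [exists x0, lam x0 == lam y] by apply/existsP; exists y.
  by move=> /(_ isT); lia.
by rewrite cardsU1 inE xl' -leqNgt ll'.
Qed.

(** The cuts give [k] slabs of [2n] variables and a last slab with the rest. A bad colouring nearly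
    balances at least half of the [k] slabs; for any other, more than half have discrepancy at least
    [2t], which amounts to [t * k] in total. *)
Lemma read_once_sep A lam D s k n t u v : injective lam -> (#|T| <= s)%N ->
  (forall l u v, depends [set x | lam x == l] (A l u v)) ->
  (forall l u v S, (D <= l)%N -> A l u v S = (u == v)%:R) ->
  (0 < n)%N -> (k * n.*2 <= #|V|)%N -> ((16 * t.*2) ^ 2 <= n.*2)%N ->
  exists bad : {set {set V}}, (#|bad| * 2 ^ k <= 2 ^ #|V|)%N /\
    forall Y, Y \notin bad ->
      sep Y (s ^ k.+1 * 2 ^ (#|V| - t * k)./2) (walk A 0 D u v).
Proof.
move=> lam_inj Ts Alam Aid n0 knV tn.
have many := @card_many_nearly_balanced V t n k _ tn; clear tn.
pose cnt l := #|[set x | (lam x < l)%N]|.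
have [f fE] : exists f : 'I_k.+1 -> nat, forall b, cnt (f b) = (b * n.*2)%N.
  suff H (b : 'I_k.+1) : exists l, cnt l = (b * n.*2)%N by apply: fin_all_exists H.
  apply: injective_cut => //; apply: leq_trans knV.
  by rewrite leq_mul2r -ltnS ltn_ord orbT.
(* Values of [lam] may exceed [D], and so may the cuts. The maximum keeps them increasing, and the
   transitions beyond [D] are trivial. *)
pose d b := if b == 0%N then 0%N else
  if (b <= k)%N then f (inord b) else maxn D (if k == 0%N then 0%N else f ord_max).
have cntd b : (b <= k)%N -> cnt (d b) = (b * n.*2)%N.
  move=> bk; rewrite /d; case: eqP => [->|_].
    by rewrite mul0n; apply/eqP; rewrite cards_eq0; apply/eqP/setP=> x; rewrite !inE.
  by rewrite bk fE inordK.
have cnt_mono l l' : (l <= l')%N -> (cnt l <= cnt l')%N.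
  by move=> ll'; apply/subset_leq_card/subsetP=> x; rewrite !inE; lia.
have dk : d k.+1 = maxn D (d k).
  rewrite /d /= ltnn; congr maxn; case: eqP => // _; rewrite leqnn.
  by congr f; apply: val_inj; rewrite /= inordK.
have dmono b : (b < k.+1)%N -> (d b <= d b.+1)%N.
  rewrite ltnS leq_eqVlt => /orP[/eqP->|bk]; first by rewrite dk leq_maxr.
  rewrite leqNgt; apply/negP=> lt; have := cnt_mono _ _ (ltnW lt).
  rewrite (cntd _ bk) (cntd _ (ltnW bk)) leq_mul2r ltnn orbF double_eq0.
  by rewrite eqn0Ngt n0.
have cardB b : (b <= k)%N -> (#|slab lam d b| + cnt (d b) = cnt (d b.+1))%N.
  move=> bk; rewrite /cnt -(cardsID [set x | (lam x < d b)%N] [set x | (lam x < d b.+1)%N]).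
  rewrite addnC; congr (_ + _)%N; apply: eq_card => x; rewrite !inE.
    by have := dmono b bk; lia.
  by rewrite -leqNgt.
have slab2n b : (b < k)%N -> #|slab lam d b| = n.*2.
  by move=> bk; have := cardB b (ltnW bk); rewrite (cntd _ bk) (cntd _ (ltnW bk)) mulSn => /addIn.
have dchain b b' : (b <= b')%N -> (b' <= k)%N -> (d b <= d b')%N.
  elim: b' => [|b' IH]; first by rewrite leqn0 => /eqP->.
  rewrite leq_eqVlt => /orP[/eqP->//|bb'] b'k.
  by apply: leq_trans (IH _ _) (dmono _ _); lia.
have disj b b' : (b < b')%N -> (b' < k)%N -> [disjoint slab lam d b & slab lam d b'].
  move=> bb' b'k; rewrite -setI_eq0; apply/eqP/setP=> x; rewrite !inE.
  by have := dchain b.+1 b' bb' (ltnW b'k); lia.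
exists [set Y | (k <= (\sum_(b < k) nearly_balanced t.*2 (slab lam d b) Y) * 2)%N].
split; first exact: many slab2n disj.
move=> Y; rewrite inE -ltnNge => good.
have walkE S : walk A 0 (d k.+1) u v S = walk A 0 D u v S.
  have walk_id l m w : (D <= l)%N -> walk A l m w v S = (w == v)%:R.
    elim: m l w => //= m IH l w Dl; rewrite (bigD1 w) //= Aid // eqxx mul1r IH; last by lia.
    rewrite big1 ?addr0 // => w' ww'; rewrite Aid // eq_sym (negbTE ww') mul0r //.
  have -> : d k.+1 = (D + (d k.+1 - D))%N by rewrite subnKC // dk leq_maxl.
  rewrite walkD add0n (bigD1 v) //= [walk A D _ _ _ _]walk_id // eqxx mulr1 big1 ?addr0 // => w wv.
  by rewrite [walk A D _ _ _ _]walk_id // (negbTE wv) mulr0.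
apply: sep_ext walkE _.
have := walk_sep Y u v Alam dmono; rewrite {2 3}/d /= subn0; apply: sep_leq.
apply: leq_mul; first by rewrite leq_exp2r.
(* Nothing is known about the discrepancy of the last slab; it is bounded by half of its size. *)
rewrite leq_exp2l // big_ord_recr /=; set mk := minn #|slab lam d k :&: Y| _.
have mk2 : (mk * 2 <= #|slab lam d k|)%N.
  by rewrite muln2 -addnn -(cardsID Y) leq_add ?geq_minl ?geq_minr.
have cV : (cnt (d k.+1) <= #|V|)%N by apply: max_card.
have ck := cardB k (leqnn k); rewrite cntd // in ck.
have le b : (b < k)%N -> (minn #|slab lam d b :&: Y| #|slab lam d b :\: Y| * 2 + t.*2
    <= n.*2 + nearly_balanced t.*2 (slab lam d b) Y * t.*2)%N.
  move=> bk; have := cardsID Y (slab lam d b); rewrite /nearly_balanced slab2n //.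
  by case: ltnP; lia.
have {le} : (\sum_(b < k) (minn #|slab lam d b :&: Y| #|slab lam d b :\: Y| * 2 + t.*2)
    <= \sum_(b < k) (n.*2 + nearly_balanced t.*2 (slab lam d b) Y * t.*2))%N.
  by apply: leq_sum => b _; apply: le.
rewrite !big_split /= -!big_distrl /= !sum_nat_const card_ord.
move: (\sum_(b < k) _)%N (\sum_(b < k) _)%N good => M nb good le.
have nbt : (nb * 2 * t <= k * t)%N by rewrite leq_mul2r ltnW ?orbT.
have : ((M + mk) * 2 + t * k <= #|V|)%N by clear -le nbt ck cV mk2; lia.
move=> H; rewrite geq_half_double -muln2 leq_subRL; first by rewrite addnC.
exact: leq_trans (leq_addl _ _) H.
Qed.

End Walk.

(** * Multilinear r-pass programs *)

Section Checkpoints.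
Variable X : eqType.
Implicit Types (L M : seq X) (Ls Ms : seq (seq X)).
Local Open Scope nat_scope.

(** Lists of length at most 1 are never split by a cut of the flattened sequence, so the cut falls
    between two of them. *)
Lemma subseq_flatten_cut Ls M R : all (fun L => size L <= 1) Ls ->
  subseq (flatten Ls) (M ++ R) ->
  exists k, subseq (flatten (take k Ls)) M /\ subseq (flatten (drop k Ls)) R.
Proof.
elim: M Ls => [|a M IHM] Ls; first by move=> _ sub; exists 0; rewrite take0 drop0.
elim: Ls => [|L Ls IHL]; first by exists 0; rewrite !sub0seq.
case: L => [|y [|]] //= sLs; first by move=> /(IHL sLs)[k Hk]; exists k.+1.
case: eqP => [->|_] sub.
  by have [k [H1 H2]] := IHM _ sLs sub; exists k.+1; rewrite /= eqxx.
have [k [H1 H2]] := IHM ([:: y] :: Ls) sLs sub.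
by exists k; split=> //; apply: subseq_trans H1 (subseq_cons _ _).
Qed.

Lemma uniq_flatten_nth Ls l l' x : uniq (flatten Ls) -> l < l' -> l' < size Ls ->
  x \in nth [::] Ls l -> x \in nth [::] Ls l' -> False.
Proof.
move=> uLs ll' l's xl xl'; move: uLs.
rewrite -(cat_take_drop l.+1 Ls) flatten_cat cat_uniq => /and3P[_ /hasPn H _].
have /H/negP[] : x \in flatten (drop l.+1 Ls).
  apply/flattenP; exists (nth [::] Ls l') => //.
  rewrite -(subnKC ll') -nth_drop mem_nth // size_drop ltn_sub2r //.
  exact: leq_ltn_trans ll' l's.
apply/flattenP; exists (nth [::] Ls l) => //.
by rewrite -(@nth_take l.+1) // mem_nth // size_take_min leq_min ltnSn (ltn_trans ll' l's).
Qed.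

(** [c j] is the layer at which pass [j] ends. A pass contains a variable at most once, so two
    layers reading the same variable are separated by the end of a pass. *)
Lemma exists_checkpoints Ms Ls : all uniq Ms -> all (fun L => size L <= 1) Ls ->
  subseq (flatten Ls) (flatten Ms) ->
  exists c : nat -> nat, forall l l' x, l < l' -> l' < size Ls ->
    x \in nth [::] Ls l -> x \in nth [::] Ls l' ->
    exists j, [/\ j < size Ms, l < c j & c j <= l'].
Proof.
elim: Ms Ls => [|M Ms IH] Ls.
  move=> _ _; rewrite [flatten [::]]/= subseq0 => /eqP e; exists id => l l' x ll' l's xl _.
  have : x \in flatten Ls.
    by apply/flattenP; exists (nth [::] Ls l) => //; apply: mem_nth (ltn_trans ll' l's).
  by rewrite e.
move=> /= /andP[uM uMs] sLs /(subseq_flatten_cut sLs)[k [sub1 sub2]].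
have sdrop : all (fun L => size L <= 1) (drop k Ls).
  by move: sLs; rewrite -{1}(cat_take_drop k Ls) all_cat => /andP[].
have [c cP] := IH _ uMs sdrop sub2.
exists (fun j => if j is j'.+1 then k + c j' else k) => l l' x ll' l's xl xl'.
have [kl|lk] := leqP k l.
  have [||||j [jM lc cl]] := cP (l - k) (l' - k) x.
  - by lia.
  - rewrite size_drop ltn_sub2r //; exact: leq_ltn_trans kl (ltn_trans ll' l's).
  - by rewrite nth_drop subnKC.
  - by rewrite nth_drop subnKC //; lia.
  by exists j.+1; split=> //; lia.
have [kl'|l'k] := leqP k l'; first by exists 0; split.
case: (@uniq_flatten_nth (take k Ls) l l' x (subseq_uniq sub1 uM) ll').
- by rewrite size_take_min leq_min l'k.
- by rewrite nth_take.
- by rewrite nth_take.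
Qed.

End Checkpoints.

Lemma uniq_pmap_nth (X Z : eqType) (h : Z -> option X) (z : seq Z) z0 l l' x :
  uniq (pmap h z) -> (l < l')%N -> (l' < size z)%N ->
  h (nth z0 z l) = Some x -> h (nth z0 z l') = Some x -> False.
Proof.
move=> uz ll' l's hl hl'; move: uz.
rewrite -(cat_take_drop l.+1 z) pmap_cat cat_uniq => /and3P[_ /hasPn H _].
have /H/negP[] : x \in pmap h (drop l.+1 z).
  rewrite mem_pmap -hl'; apply: map_f.
  rewrite -(subnKC ll') -nth_drop mem_nth // size_drop ltn_sub2r //.
  exact: leq_ltn_trans ll' l's.
rewrite /= mem_pmap -hl; apply: map_f.
by rewrite -(@nth_take l.+1) // mem_nth // size_take_min leq_min ltnSn (ltn_trans ll' l's).
Qed.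

Section WalkSum.
Variables (K : fieldType) (V T : finType).
Implicit Types (A : nat -> T -> T -> {set V} -> K).

Lemma walk_sum A l n u v S : walk A l n u v S =
  \sum_(p : n.-tuple T | last u p == v)
    \prod_(i < n) A (l + i)%N (nth u (u :: p) i) (nth u p i) S.
Proof.
elim: n l u => [|n IH] l u /=.
  rewrite (eq_bigl (fun p : 0.-tuple T => u == v)) => [|p]; last by rewrite tuple0.
  case: eqP => _; last by rewrite big_pred0.
  rewrite (big_pred1 [tuple]) => [|p]; last by rewrite (tuple0 p) /= eqxx.
  by rewrite big_ord0.
rewrite (reindex (fun q : T * n.-tuple T => [tuple of q.1 :: q.2])) /=; last first.
  exists (fun p : n.+1.-tuple T => (thead p, [tuple of behead p])) => [[w p]|p] _ /=.
    by rewrite theadE; congr (_, _); apply: val_inj.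
  by rewrite -tuple_eta.
rewrite -(pair_big_dep xpredT (fun w p => last w (tval p) == v) (fun w (p : n.-tuple T) =>
  \prod_(i < n.+1) A (l + i)%N (nth u (u :: w :: p) i) (nth u (w :: p) i) S)) /=.
apply: eq_bigr => w _; rewrite IH big_distrr /=; apply: eq_bigr => p _.
rewrite big_ord_recl /= addn0; congr (_ * _); apply: eq_bigr => i _.
rewrite /bump /= add1n addnS -addSn.
congr (A _ _ _ S); apply: set_nth_default; rewrite /= size_tuple; first exact: ltnW (ltn_ord i).
exact: ltn_ord.
Qed.

End WalkSum.

(** * Paths of a program grouped by their nodes at the checkpoints *)

Section Reduction.
Variables (K : fieldType) (N : nat) (P : abp K N).
Local Notation T := (node P).
Local Notation D := (depth P).
Local Notation s := (source P).
Local Notation t := (sink P).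

Definition label_val (S : {set 'I_N}) (l : label K N) : K :=
  match l with inl i => (i \in S)%:R | inr c => c end.

Lemma bool_eval_label S l : bool_eval (label_poly l) S = label_val S l.
Proof. by case: l => [i|c]; rewrite /bool_eval /= ?mevalXU ?mevalC. Qed.

Definition arc_val u v S := oapp (label_val S) 0 (@arc _ _ P u v).

Lemma path_layer u p : path (fun u v => isSome (@arc _ _ P u v)) u p ->
  layer (last u p) = (layer u + size p)%N.
Proof.
elim: p u => [|v p IH] u /=; first by rewrite addn0.
by case/andP=> /arc_layer uv /IH ->; rewrite uv addnS addSn.
Qed.

Lemma st_path_size p : st_path (P := P) p -> size p = D.
Proof.
by case/andP=> /path_layer e /eqP pt; move: e; rewrite pt source_layer sink_layer.
Qed.

Lemma st_path_layer p i : st_path p -> (i <= size p)%N -> layer (nth s (s :: p) i) = i.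
Proof.
case/andP=> sp _ ip; move: sp; rewrite -{1}(cat_take_drop i p) cat_path => /andP[sp _].
move/path_layer: sp; rewrite source_layer add0n size_take_min (minn_idPl ip) => e.
rewrite -[RHS]e (last_nth s) size_take_min (minn_idPl ip).
by rewrite -[s :: take i p]/(take i.+1 (s :: p)) nth_take.
Qed.

Lemma prod_path_labels u p S : path (fun u v => isSome (@arc _ _ P u v)) u p ->
  \prod_(l <- pmap (fun e => @arc _ _ P e.1 e.2) (zip (u :: p) p)) label_val S l =
  \prod_(i < size p) arc_val (nth u (u :: p) i) (nth u p i) S.
Proof.
elim: p u => [|v p IH] u /=; first by rewrite big_nil big_ord0.
rewrite big_ord_recl /= {1}/arc_val; case: (arc u v) => //= l vp.
rewrite big_cons IH //; congr (_ * _); apply: eq_bigr => i _.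
congr (arc_val _ _ S); apply: set_nth_default => //=; exact: ltnW (ltn_ord i).
Qed.

(** Layering forces all source-sink paths to have length [D], so one length contributes; the other
    branch is the case of [D] outside the summation range. *)
Lemma bool_eval_abp S : bool_eval (abp_poly P) S =
  if (D < abp_size P)%N then
    \sum_(p : D.-tuple T | st_path p)
      \prod_(i < D) arc_val (nth s (s :: p) i) (nth s p i) S
  else 0.
Proof.
rewrite /abp_poly /bool_eval raddf_sum /=.
have z (d : 'I_(abp_size P)) : d != D :> nat ->
    (\sum_(p : d.-tuple T | st_path p) \prod_(l <- path_labels p) label_poly l)
      .@[fun a => (a \in S)%:R] = 0.
  move=> dD; rewrite big_pred0 ?meval0 // => p; apply/negP=> /st_path_size.
  by rewrite size_tuple => e; rewrite e eqxx in dD.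
case: ifP => [DP|/negbT DP]; last first.
  by apply: big1 => d _; apply: z; apply: contraNneq DP => <-.
rewrite (bigD1 (Ordinal DP)) //= [X in _ + X]big1 ?addr0 => [|d dD]; last exact: z.
rewrite raddf_sum /=; apply: eq_bigr => p pP.
case/andP: pP => /(prod_path_labels S); rewrite size_tuple => <- _.
rewrite rmorph_prod.
by apply: eq_bigr => l _; rewrite -bool_eval_label.
Qed.

Section Signature.
Variables (r : nat) (c : 'I_r -> nat) (sg : {ffun 'I_r -> T}).

Definition signature (p : seq T) : {ffun 'I_r -> T} :=
  [ffun j => nth s (s :: p) (c j)].

Definition sg_path (p : D.-tuple T) := st_path p && (signature p == sg).

Definition useful l v w := [exists p : D.-tuple T,
  [&& sg_path p, nth s (s :: p) l == v & nth s p l == w]].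

(** Only arcs on some path of signature [sg] are kept; the identity beyond the last layer is the
    padding that [read_once_sep] expects. *)
Definition sg_arc l v w S :=
  if (l < D)%N then if useful l v w then arc_val v w S else 0 else (v == w)%:R.

(** No path of another signature survives: its arc leaving layer [c j] is useful, hence starts at
    the node that [sg] prescribes. *)
Lemma walk_sg_arc S : (exists p, sg_path p) -> walk sg_arc 0 D s t S =
  \sum_(p | sg_path p) \prod_(i < D) arc_val (nth s (s :: p) i) (nth s p i) S.
Proof.
move=> [p0 p0P]; rewrite walk_sum (bigID sg_path) /= [X in _ + X]big1 ?addr0.
  apply: eq_big => [p|p /andP[_ pP]].
    by rewrite andbC; case: (boolP (sg_path p)) => //= /andP[/andP[_ ->]].
  apply: eq_bigr => i _; rewrite /sg_arc add0n ltn_ord ifT //.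
  by apply/existsP; exists p; rewrite pP !eqxx.
move=> p /andP[pt pP]; apply/eqP; rewrite prodf_seq_eq0 /=; apply: contraR pP => nz.
have useP (i : 'I_D) : useful i (nth s (s :: p) i) (nth s p i)
    && isSome (arc (nth s (s :: p) i) (nth s p i)).
  apply: contraR nz => nu; apply/hasP; exists i; first exact: mem_index_enum.
  rewrite /sg_arc /= add0n ltn_ord; move: nu; case: useful => //=.
  by rewrite /arc_val; case: arc => //= _; rewrite eqxx.
have stp : st_path p.
  rewrite /st_path pt andbT; apply/(pathP s) => i; rewrite size_tuple => iD.
  by have /andP[] := useP (Ordinal iD).
rewrite /sg_path stp; apply/eqP/ffunP=> j; rewrite ffunE.
have [lt|ge] := ltnP (c j) D.
  have /andP[/existsP[p' /and3P[/andP[_ /eqP <-] /eqP e _]] _] := useP (Ordinal lt).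
  by rewrite ffunE e.
(* A checkpoint at layer [D] is passed at the sink, and beyond [D] every path gives the default
   value; the path [p0] shows that [sg] agrees. *)
case/andP: p0P => /andP[_ p0t] /eqP <-; rewrite ffunE.
move: ge; rewrite leq_eqVlt => /orP[/eqP <-|gt]; last by rewrite !nth_default //= size_tuple.
have nthD (q : D.-tuple T) : nth s (s :: q) D = last s q.
  by rewrite (last_nth s) size_tuple.
by rewrite !nthD (eqP pt) (eqP p0t).
Qed.

Hypothesis obl : oblivious P.
Hypothesis sml : syntactic_multilinear P.
Hypothesis cP : forall l l' x, (l < l')%N -> (l' < D)%N ->
  x \in layer_vars P l -> x \in layer_vars P l' ->
  exists j, [/\ (l < c j)%N & (c j <= l')%N].

Definition reads l x := [exists v, exists w,
  useful l v w && (arc v w == Some (inl x : label K N))].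

Lemma readsP l x : (l < D)%N -> reads l x -> exists p : D.-tuple T,
  sg_path p /\ arc (nth s (s :: p) l) (nth s p l) = Some (inl x : label K N).
Proof.
move=> lD /existsP[v /existsP[w /andP[/existsP[p /and3P[pP /eqP <- /eqP <-]] /eqP e]]].
by exists p.
Qed.

Lemma reads_layer_vars l x : (l < D)%N -> reads l x -> x \in layer_vars P l.
Proof.
move=> lD /(readsP lD)[p [/andP[pP _] e]].
rewrite mem_filter mem_enum andbT; apply/existsP; exists (nth s (s :: p) l).
apply/existsP; exists (nth s p l); rewrite e eqxx andbT.
by rewrite st_path_layer // size_tuple ltnW.
Qed.

(** Two paths of the same signature meet at the checkpoint between [l] and [l']. Following one up to
    it and the other from there on gives a path reading [x] twice, against multilinearity. *)
Lemma reads_lt l l' x : (l < l')%N -> (l' < D)%N -> reads l x -> reads l' x -> False.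
Proof.
move=> ll' l'D rl rl'; have lD := ltn_trans ll' l'D.
have [j [lc cl']] := cP ll' l'D (reads_layer_vars lD rl) (reads_layer_vars l'D rl').
have [p [/andP[pP /eqP psg] px]] := readsP lD rl.
have [p' [/andP[pP' /eqP psg'] px']] := readsP l'D rl'.
have cD : (c j < D)%N by apply: leq_ltn_trans l'D.
pose q := take (c j) p ++ drop (c j) p'.
have sq : size q = D.
  by rewrite size_cat size_take_min size_drop !size_tuple (minn_idPl (ltnW cD)) subnKC // ltnW.
have q1 i : (i < c j)%N -> nth s q i = nth s p i.
  by move=> ic; rewrite nth_cat size_take_min size_tuple (minn_idPl (ltnW cD)) ic nth_take.
have q2 i : (c j <= i)%N -> nth s q i = nth s p' i.
  move=> ic; rewrite nth_cat size_take_min size_tuple (minn_idPl (ltnW cD)) ltnNge ic /=.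
  by rewrite nth_drop subnKC.
have pp' : nth s (s :: p) (c j) = nth s (s :: p') (c j).
  by move/ffunP/(_ j): psg; move/ffunP/(_ j): psg'; rewrite !ffunE => -> ->.
have q1' i : (i <= c j)%N -> nth s (s :: q) i = nth s (s :: p) i.
  by case: i => //= i ic; apply: q1.
have q2' i : (c j <= i)%N -> nth s (s :: q) i = nth s (s :: p') i.
  rewrite leq_eqVlt => /orP[/eqP <-|]; first by rewrite q1'.
  by case: i => //= i ic; apply: q2.
have qP : st_path q.
  case/andP: pP => /(pathP s) pP _; case/andP: pP' => /(pathP s) pP' /eqP pt'.
  apply/andP; split.
    apply/(pathP s) => i; rewrite sq => iD.
    have [ic|ic] := ltnP i (c j).
      by rewrite q1' ?(ltnW ic) // q1 //; apply: pP; rewrite size_tuple.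
    by rewrite q2' // q2 //; apply: pP'; rewrite size_tuple.
  rewrite -pt' (last_nth s) sq [X in _ == X](last_nth s) size_tuple q2' //.
  exact: ltnW.
pose h (e : T * T) := obind (@label_var K N) (arc e.1 e.2).
have := sml qP; rewrite /path_labels.
have -> : pmap (@label_var K N) (pmap (fun e => arc e.1 e.2) (zip (s :: q) q)) =
          pmap h (zip (s :: q) q).
  elim: (zip _ _) => //= e z IH; rewrite /h; case: (arc e.1 e.2) => //= lb.
  by rewrite IH.
have sz : size (zip (s :: q) q) = D by rewrite size_zip /= sq (minn_idPr (leqnSn _)).
have nz i : (i < D)%N -> nth (s, s) (zip (s :: q) q) i = (nth s (s :: q) i, nth s q i).
  by move=> iD; rewrite nth_zip_cond sz iD.
move=> uq; apply: (@uniq_pmap_nth _ _ h _ (s, s) l l' x uq ll').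
- by rewrite sz.
- by rewrite nz // /h /= q1' ?(ltnW lc) // q1 // px.
- by rewrite nz // /h /= q2' // q2 // px'.
Qed.

Lemma reads_inj l l' x : (l < D)%N -> (l' < D)%N -> reads l x -> reads l' x -> l = l'.
Proof.
move=> lD l'D rl rl'; case: (ltngtP l l') => // ll'.
  by case: (reads_lt ll' l'D rl rl').
by case: (reads_lt ll' lD rl' rl).
Qed.

(* Variables that are never read get pairwise distinct layers beyond the last. *)
Definition read_layer (x : 'I_N) : nat :=
  if [pick l : 'I_D | reads l x] is Some l then l else (D + x)%N.

Lemma read_layer_inj : injective read_layer.
Proof.
move=> x y; rewrite /read_layer.
case: pickP => [l lx|_]; case: pickP => [l' ly|_] e.
- have := obl l; move: (reads_layer_vars (ltn_ord l) lx).
  move: (reads_layer_vars (ltn_ord l') ly); rewrite -e.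
  case: (layer_vars P l) => [|z [|]] //=; rewrite !inE => /eqP -> /eqP ->.
  by [].
- by have := ltn_ord l; rewrite e ltnNge leq_addr.
- by have := ltn_ord l'; rewrite -e ltnNge leq_addr.
- by apply: val_inj; apply: (@addnI D).
Qed.

Lemma sg_arc_depends l v w : depends [set x | read_layer x == l] (sg_arc l v w).
Proof.
move=> S S' e; rewrite /sg_arc; case: ltnP => // lD; case: ifP => // uvw.
rewrite /arc_val; case a: (arc v w) => [[x|]|] //=.
have rx : reads l x by apply/existsP; exists v; apply/existsP; exists w; rewrite uvw a eqxx.
move/setP/(_ x): e; rewrite !inE /read_layer.
case: pickP => [l0 l0x|/(_ (Ordinal lD))]; last by rewrite /= rx.
by rewrite (reads_inj (ltn_ord l0) lD l0x rx) eqxx !andbT => ->.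
Qed.

End Signature.

End Reduction.

(** * The lower bound *)

Lemma card_bigcup_leq (I V : finType) (U : {pred I}) (B : I -> {set V}) M X :
  (forall i, i \in U -> (#|B i| * M <= X)%N) ->
  (#|\bigcup_(i in U) B i| * M <= #|U| * X)%N.
Proof.
move=> BX; rewrite -[leqRHS]sum_nat_const.
apply: (big_rec2 (fun (A : {set V}) x => #|A| * M <= x)%N) => [|i A x iU Ax].
  by rewrite cards0.
apply: leq_trans (_ : (#|B i| + #|A|) * M <= _)%N; last by rewrite mulnDl leq_add ?BX.
by rewrite leq_mul2r (leq_card_setU (B i) A) orbT.
Qed.

Lemma pass_abp_sep (K : fieldType) (N : nat) (P : abp K N) r s k n t :
  multilinear_pass P r -> (abp_size P <= s)%N ->
  (0 < n)%N -> (k * n.*2 <= N)%N -> ((16 * t.*2) ^ 2 <= n.*2)%N ->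
  exists bad : {set {set 'I_N}}, (#|bad| * 2 ^ k <= s ^ r * 2 ^ N)%N /\
    forall Y, Y \notin bad ->
      sep Y (s ^ r * (s ^ k.+1 * 2 ^ (N - t * k)./2)) (bool_eval (abp_poly P)).
Proof.
move=> [obl sml [pi sub]] Ps n0 kn tn.
have [c cP] : exists c : 'I_r -> nat, forall l l' x, (l < l')%N -> (l' < depth P)%N ->
    x \in layer_vars P l -> x \in layer_vars P l' ->
    exists j, [/\ (l < c j)%N & (c j <= l')%N].
  have uM : all uniq [seq [seq pi k i | i <- enum 'I_N] | k <- enum 'I_r].
    apply/allP=> _ /mapP[j _ ->]; rewrite map_inj_uniq ?enum_uniq //; exact: perm_inj.
  have sL : all (fun L : seq 'I_N => size L <= 1)%N
      [seq layer_vars P l | l <- iota 0 (depth P)].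
    by apply/allP=> _ /mapP[l _ ->]; apply: obl.
  have [c cP] := exists_checkpoints uM sL sub.
  exists (fun j => c j) => l l' x ll' l'D xl xl'.
  have nthL i : (i < depth P)%N ->
      nth [::] [seq layer_vars P l | l <- iota 0 (depth P)] i = layer_vars P i.
    by move=> iD; rewrite (nth_map 0%N) ?size_iota // nth_iota.
  have [|||j [jr lc cl]] := cP l l' x ll'.
  - by rewrite size_map size_iota.
  - by rewrite nthL // (ltn_trans ll').
  - by rewrite nthL.
  rewrite size_map -cardE card_ord in jr.
  by exists (Ordinal jr).
have ro sg : exists bad : {set {set 'I_N}}, (#|bad| * 2 ^ k <= 2 ^ N)%N /\
    forall Y, Y \notin bad -> sep Y (s ^ k.+1 * 2 ^ (N - t * k)./2)
      (walk (sg_arc c sg) 0 (depth P) (source P) (sink P)).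
  have := @read_once_sep K 'I_N (node P) (sg_arc c sg)
    (read_layer c sg) (depth P) s k n t (source P) (sink P).
  rewrite !card_ord; apply=> //.
  - exact: read_layer_inj.
  - exact: sg_arc_depends.
  - by move=> l u v S Dl; rewrite /sg_arc ltnNge Dl.
have {ro} [bad badP] := fin_all_exists ro.
(* Only signatures that occur are summed over, because [walk_sg_arc] asks for a path with the given
   signature. *)
pose U := [set signature c p | p : (depth P).-tuple (node P) & st_path p].
have cU : (#|U| <= s ^ r)%N.
  apply: leq_trans (max_card _) _; rewrite card_ffun card_ord.
  by case: (r) => [|r'] //; rewrite leq_exp2r.
exists (\bigcup_(sg in U) bad sg); split.
  apply: leq_trans (card_bigcup_leq (X := 2 ^ N) _) _ => [sg _|].
    by case: (badP sg).
  by rewrite leq_mul2r cU orbT.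
move=> Y /bigcupP nbad.
have [DP|DP] := boolP (depth P < abp_size P)%N; last first.
  by apply: sep_ext (sep0 _ _ _) => S; rewrite bool_eval_abp (negbTE DP).
apply: (@sep_leq _ _ _ (#|U| * (s ^ k.+1 * 2 ^ (N - t * k)./2))).
  by rewrite leq_mul2r cU orbT.
have e S : \sum_(sg in U) walk (sg_arc c sg) 0 (depth P) (source P) (sink P) S
    = bool_eval (abp_poly P) S.
  rewrite bool_eval_abp DP 
    (partition_big (fun p : (depth P).-tuple (node P) => signature c p) (mem U)) /=;
    last by move=> p pP; apply: imset_f; rewrite inE.
  apply: eq_bigr => sg /imsetP[p0]; rewrite inE => p0P sgE.
  by apply: walk_sg_arc; exists p0; rewrite /sg_path p0P sgE eqxx.
apply: sep_ext e _; apply: sep_sum_in => sg sgU.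
by case: (badP sg) => _; apply; apply/negP=> Ybad; case: nbad; exists sg.
Qed.

Lemma no_small_pass_sum (F : fieldType) (N r m s k : nat)
    (P : 'I_m -> abp (WField F N) N) :
  ~~ odd N -> (forall i, multilinear_pass (P i) r) ->
  (forall i, abp_size (P i) <= s)%N ->
  ry F N 1 N = \sum_(i < m) abp_poly (P i) ->
  (128 <= k)%N -> (k ^ 5 <= N)%N -> (s < 2 ^ k)%N -> (N.+1 * (m * s ^ r) < 2 ^ k)%N ->
  False.
Proof.
move=> evN passP Ps ryE k128 k5 s2k msr.
(* Blocks of [(128 k)^2] variables, half of which must have discrepancy [8 k]. *)
pose n := (64 * k * (128 * k))%N; pose t := (4 * k)%N.
have n2 : n.*2 = ((128 * k) ^ 2)%N by rewrite /n; clear; lia.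
have n0 : (0 < n)%N by rewrite /n; clear -k128; nia.
have tn : ((16 * t.*2) ^ 2 <= n.*2)%N.
  by rewrite n2 leq_exp2r // /t; clear; lia.
have kn : (k * n.*2 <= N)%N.
  apply: leq_trans k5; rewrite n2 expnMn (expnD k 3 2) mulnCA -expnS mulnC.
  by rewrite leq_mul2l leq_exp2r ?k128 ?orbT.
have [bad badP] := fin_all_exists (fun i => pass_abp_sep (passP i) (Ps i) n0 kn tn).
pose h := N./2; have Nh : N = h.*2 by rewrite -(odd_double_half N) (negbTE evN).
(* At least [2^N / (N + 1)] colourings are balanced and at most [m s^r 2^N / 2^k] are bad, which is
   fewer; so some balanced [Y] is good for all programs. *)
have /subsetPn[Y] : ~~ ([set Y : {set 'I_N} | #|Y| == h] \subset \bigcup_(i in 'I_m) bad i).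
  apply/negP=> /subset_leq_card; rewrite card_draws card_ord => le.
  have : (#|\bigcup_(i in 'I_m) bad i| * 2 ^ k <= m * (s ^ r * 2 ^ N))%N.
    have := @card_bigcup_leq 'I_m _ 'I_m bad (2 ^ k) (s ^ r * 2 ^ N).
    by rewrite card_ord; apply=> i _; case: (badP i).
  move=> /(leq_trans (leq_mul le (leqnn _))) le2.
  have := exp4_leq_bin h; rewrite -Nh => le3.
  have e4 : (4 ^ h = 2 ^ N)%N by rewrite [in RHS]Nh -mul2n expnM.
  have pos : (0 < 2 ^ N)%N by rewrite expn_gt0.
  have : (2 ^ N * 2 ^ k <= N.+1 * (m * s ^ r) * 2 ^ N)%N.
    rewrite -{1}e4; apply: leq_trans (leq_mul le3 (leqnn _)) _.
    by rewrite -!mulnA leq_mul2l le2 orbT.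
  by rewrite mulnC leq_pmul2r // leqNgt msr.
rewrite inE => /eqP Yh /bigcupP Ybad.
have : (2 ^ #|Y| <= m * (s ^ r * (s ^ k.+1 * 2 ^ (N - t * k)./2)))%N.
  apply: (@ry_sep F N); first by rewrite Yh muln2 -Nh.
  have e S : \sum_(i in 'I_m) bool_eval (abp_poly (P i)) S = bool_eval (ry F N 1 N) S.
    by rewrite ryE /bool_eval raddf_sum.
  apply: sep_ext e _; rewrite -[X in (X * _)%N](card_ord m).
  apply: sep_sum_in => i _; case: (badP i) => _; apply; apply/negP=> Yi; case: Ybad; by exists i.
rewrite Yh => le.
have h2k : (2 * k ^ 2 <= h)%N.
  have : (4 * k ^ 2 <= N)%N.
    apply: leq_trans k5; rewrite (expnD k 3 2) leq_mul2r; apply/orP; right.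
    by clear -k128; nia.
  by rewrite {1}Nh; clear; lia.
have hE : ((N - t * k)./2 = h - 2 * k ^ 2)%N by rewrite {1}Nh /t; clear; lia.
have : (2 ^ (2 * k ^ 2) <= m * (s ^ r * s ^ k.+1))%N.
  have pos : (0 < 2 ^ (h - 2 * k ^ 2))%N by rewrite expn_gt0.
  by rewrite -(leq_pmul2r pos) -expnD subnKC // -!mulnA -hE.
(* The right side is below [2^k * 2^(k (k + 1)) = 2^(k^2 + 2k)], which is at most [2^(2 k^2)]. *)
rewrite leqNgt => /negP; apply.
have lt1 : (m * s ^ r < 2 ^ k)%N.
  by apply: leq_ltn_trans msr; rewrite leq_pmull.
have le1 : (s ^ k.+1 <= 2 ^ (k * k.+1))%N by rewrite expnM leq_exp2r // ltnW.
rewrite mulnA; apply: leq_ltn_trans (leq_mul (leqnn _) le1) _.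
apply: leq_trans (_ : 2 ^ k * 2 ^ (k * k.+1) <= _)%N.
  by rewrite ltn_pmul2r ?expn_gt0.
rewrite -expnD leq_exp2l //; clear -k128; nia.
Qed.

(** Otherwise every contributing program has depth 0, so the sum is constant on Boolean points and
    separable with one term, against [ry_sep]. *)
Lemma abp_size_gt1 (F : fieldType) (N m s : nat) (P : 'I_m -> abp (WField F N) N) :
  (0 < N)%N -> ~~ odd N -> (forall i, abp_size (P i) <= s)%N ->
  ry F N 1 N = \sum_(i < m) abp_poly (P i) -> (1 < s)%N.
Proof.
move=> N0 evN Ps ryE; rewrite ltnNge; apply/negP=> s1.
pose h := N./2; have Nh : N = h.*2 by rewrite -(odd_double_half N) (negbTE evN).
have : (0 < #|[set Y : {set 'I_N} | #|Y| == h]|)%N.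
  by rewrite card_draws card_ord bin_gt0 Nh -addnn leq_addr.
case/card_gt0P=> Y; rewrite inE => /eqP Yh.
have dep0 : depends set0 (bool_eval (ry F N 1 N)).
  move=> S S' _; rewrite ryE /bool_eval !raddf_sum /=; apply: eq_bigr => i _.
  have := bool_eval_abp (P i) S; have := bool_eval_abp (P i) S'.
  rewrite /bool_eval => -> ->; case: ifP => // lt; apply: eq_bigr => p _.
  have D0 : depth (P i) = 0%N by have := leq_trans lt (leq_trans (Ps i) s1); case: depth.
  have no (a : 'I_(depth (P i))) : False by have := ltn_ord a; rewrite {2}D0.
  by apply: eq_bigr => a; case: (no a).
have := sep_depends Y dep0; rewrite set0I set0D cards0 => /ry_sep.
rewrite Yh muln2 -Nh => /(_ erefl); rewrite -{2}(expn0 2) leq_exp2l // leqn0 => /eqP h0.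
by rewrite Nh h0 in N0.
Qed.

(** * Real estimates and the choice of constants *)

Local Open Scope R_scope.

Lemma INR_muln a b : INR (a * b)%N = INR a * INR b.
Proof. by rewrite -mult_INR. Qed.

Lemma INR_expn a b : INR (a ^ b)%N = INR a ^ b.
Proof. by elim: b => [|b IH] //=; rewrite expnS INR_muln IH. Qed.

Lemma INR_leq a b : (a <= b)%N -> INR a <= INR b.
Proof. by move=> /leP; apply: le_INR. Qed.

Lemma Rpower_leq a x y : 1 <= a -> x <= y -> Rpower a x <= Rpower a y.
Proof. by move=> a1 [xy|->]; [apply: Rle_Rpower; lra | right]. Qed.

Lemma Rpower_gt0 a x : 0 < Rpower a x.
Proof. exact: exp_pos. Qed.

(** [k] is the integer part of the fifth root of [N]. *)
Lemma pass_bound_nat (N r m s : nat) : (1 < N)%N -> (1 < s)%N -> (0 < m)%N ->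
  INR m < Rpower 2 (1 / 1024 * Rpower (INR N) (1 / 5))
          / Rpower (INR s) (2 * (INR r + log2 (INR N))) ->
  exists k, [/\ (128 <= k)%N, (k ^ 5 <= N)%N, (s < 2 ^ k)%N
                & (N.+1 * (m * s ^ r) < 2 ^ k)%N].
Proof.
move=> N2 s2 m1 H.
have NR : 2 <= INR N by rewrite -[2]/(INR 2); apply: INR_leq.
have sR : 2 <= INR s by rewrite -[2]/(INR 2); apply: INR_leq.
have mR : 1 <= INR m by rewrite -[1]/(INR 1); apply: INR_leq.
have rR : 0 <= INR r := pos_INR r.
have ln2 : 0 < ln 2 by rewrite -ln_1; apply: ln_increasing; lra.
have lnN : ln 2 <= ln (INR N).
  by case: NR => [lt|<-]; [left; apply: ln_increasing; lra | right].
have logN1 : 1 <= log2 (INR N).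
  by rewrite /log2; apply: (Rmult_le_reg_r (ln 2)) => //; field_simplify; lra.
have logNE : Rpower 2 (log2 (INR N)) = INR N.
  rewrite /Rpower /log2 (_ : ln (INR N) / ln 2 * ln 2 = ln (INR N)); last by field; lra.
  by rewrite exp_ln; lra.
set x := Rpower (INR N) (1 / 5) in H; set L := log2 (INR N) in H logN1 logNE.
set E := Rpower (INR s) (2 * (INR r + L)) in H.
have E0 : 0 < E by apply: Rpower_gt0.
have {H} mE : INR m * E < Rpower 2 (1 / 1024 * x).
  have := Rmult_lt_compat_r E _ _ E0 H; rewrite /Rdiv Rmult_assoc Rinv_l; lra.
(* Since [m >= 1] and [E >= s >= 2], the hypothesis gives [2 < 2^(x / 1024)]. This disposes of small
   [N]. *)
have x1024 : 1024 < x.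
  apply: Rnot_le_lt => xle.
  have h1 : Rpower 2 (1 / 1024 * x) <= Rpower 2 1 by apply: Rpower_leq; lra.
  have h2 : Rpower (INR s) 1 <= E by apply: Rpower_leq; lra.
  rewrite Rpower_1 in h1; last by lra.
  rewrite Rpower_1 in h2; last by lra.
  nra.
have ex : exists k, (k ^ 5 <= N)%N by exists 0%N.
have bnd k : (k ^ 5 <= N)%N -> (k <= N)%N.
  apply: leq_trans; case: k => // k; exact: (@leq_pexp2l k.+1 1 5).
case: (ex_maxnP ex bnd) => k k5 kmax.
have xk : x < INR k + 1.
  have : (N < k.+1 ^ 5)%N by rewrite ltnNge; apply/negP=> /kmax; rewrite ltnn.
  move=> /ltP /lt_INR; rewrite INR_expn S_INR => lt.
  have k0 := pos_INR k.
  have -> : INR k + 1 = Rpower ((INR k + 1) ^ 5) (1 / 5).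
    rewrite -Rpower_pow; last by lra.
    rewrite Rpower_mult (_ : INR 5 * (1 / 5) = 1); last by rewrite /=; field.
    by rewrite Rpower_1; lra.
  by apply: Rlt_Rpower_l; lra.
have k1024 : 1024 <= INR k + 1 by lra.
have E2k : INR m * E < INR (2 ^ k)%N.
  apply: Rlt_le_trans mE _; rewrite INR_expn -Rpower_pow; last by rewrite /=; lra.
  by apply: Rpower_leq; rewrite /=; lra.
exists k; split=> //.
- apply/leP; apply: INR_le; rewrite (_ : INR 128 = 128); last by rewrite INR_IZR_INZ.
  lra.
- apply/ltP; apply: INR_lt; apply: Rle_lt_trans E2k.
  have : Rpower (INR s) 1 <= E by apply: Rpower_leq; lra.
  rewrite Rpower_1; nra.
- apply/ltP; apply: INR_lt; apply: Rle_lt_trans E2k.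
  rewrite !INR_muln INR_expn S_INR -Rpower_pow; last by lra.
  have -> : E = Rpower (INR s) (2 * INR r) * Rpower (INR s) (2 * L).
    by rewrite -Rpower_plus /E; congr Rpower; lra.
  have h1 : Rpower (INR s) (INR r) <= Rpower (INR s) (2 * INR r) by apply: Rpower_leq; lra.
  (* The factor 2 in the exponent pays for [N + 1], which is at most [N^2 = 2^(2 L)]. *)
  have h2 : INR N + 1 <= Rpower (INR s) (2 * L).
    apply: Rle_trans (_ : Rpower 2 (2 * L) <= _).
      by rewrite (_ : 2 * L = L + L) ?Rpower_plus ?logNE; [nra | lra].
    by apply: Rle_Rpower_l; lra.
  have p1 := Rpower_gt0 (INR s) (INR r).
  rewrite Rmult_comm Rmult_assoc; apply: Rmult_le_compat_l; first by lra.
  by apply: Rmult_le_compat; lra.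
Qed.

Local Close Scope R_scope.

Theorem theorem3 :
  exists c c' : R, (0 < c)%coqR /\ (0 < c')%coqR /\
  forall (F : fieldType) (N : nat) (hN : (0 < N)%N) (hNeven : ~~ odd N)
    (r m : nat)
    (f : 'I_m -> {mpoly (WField F N)[N]})
    (P : 'I_m -> abp (WField F N) N)
    (hpass : forall i, multilinear_pass (P i) r)
    (hcomp : forall i, abp_poly (P i) = f i)
    (hsum : ry F N 1 N = \sum_(i < m) f i)
    (s : nat) (hs : s = (\max_(i < m) abp_size (P i))%N),
  (Rpower 2 (c' * Rpower (INR N) (1 / 5))
     / Rpower (INR s) (c * (INR r + log2 (INR N))) <= INR m)%coqR.
Proof.
exists 2%coqR, (1 / 1024)%coqR; split; first by lra.
split; first by lra.
move=> F N N0 evN r m f P passP fE ryE s sE.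
have {f fE}ryE : ry F N 1 N = \sum_(i < m) abp_poly (P i).
  by rewrite ryE; apply: eq_bigr => i _; rewrite fE.
have Ps i : (abp_size (P i) <= s)%N by rewrite sE (leq_bigmax i).
have s1 : (1 < s)%N := abp_size_gt1 N0 evN Ps ryE.
(* For [m = 0] the maximum is empty and [s] would be 0. *)
have m0 : (0 < m)%N.
  by case: m P sE s1 {passP ryE Ps} => // P ->; rewrite big_ord0.
have N1 : (1 < N)%N by case: N N0 evN {P passP ryE sE Ps} => [|[]].
apply: Rnot_lt_le => /(pass_bound_nat N1 s1 m0)[k [k128 k5 sk msk]].
exact: no_small_pass_sum evN passP Ps ryE k128 k5 sk msk.
Qed.
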